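(* Let $(\mathscr{A},\tau)$ be a finite, $\sigma$-finite tracial von Neumann algebra. Let $E\subseteq F$ and $Y$ be rank-complete right-$\mathscr{A}$-modules. Then any $\mathscr{A}$-module homomorphism $\varphi\in\operatorname{hom}_{\mathscr{A}}(E,Y)$ extends to an $\mathscr{A}$-module homomorphism $\bar\varphi\in\operatorname{hom}_{\mathscr{A}}(F,Y)$.
   Context: Here $\tau$ is a faithful normal trace on $\mathscr{A}$ with $\tau(1)=1$. Modules are purely algebraic. For a right-$\mathscr{A}$-module $E$ and $\xi\in E$, the rank of $\xi$ is $\operatorname{rk}(\xi)=1-\sup\{\tau(p): p\in\mathscr{A}\text{ a projection with }\xi.p=0\}\in[0,1]$. The rank function induces a pseudo-metric $d(\xi,\eta)=\operatorname{rk}(\xi-\eta)$ on $E$. The module $E$ is rank-complete if $d$ is a metric and $(E,d)$ is complete, i.e. $E$ coincides with its Hausdorff completion with respect to $d$. *)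

(* Defs.v *)
From HB Require Import structures.
From mathcomp Require Import all_boot all_order all_algebra.
From mathcomp Require Import complex.
From mathcomp Require Import sesquilinear.
From mathcomp Require Import boolp classical_sets functions cardinality reals.
From mathcomp Require Import topology normedtype.

Set Implicit Arguments.
Unset Strict Implicit.
Unset Printing Implicit Defensive.

Import Order.TTheory GRing.Theory Num.Theory.
Local Open Scope classical_set_scope.
Local Open Scope ring_scope.
Local Open Scope complex_scope.

Record hilbertSpace (R : realType) := HilbertSpace {
  hilbert_sort :> completeNormedModType R[i];
  hdot : {dot hilbert_sort for (@Num.conj R[i])};
  hdot_norm : forall x : hilbert_sort, `|x| ^+ 2 = hdot x x
}.

Section Operators.
Variables (R : realType) (H : hilbertSpace R).
Implicit Types (S T : H -> H) (A : set (H -> H)).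

Definition bounded_operator T : Prop := linear T /\ continuous T.

Definition is_adjoint S T : Prop := forall x y, hdot H (S x) y = hdot H x (T y).

Definition commutant A : set (H -> H) :=
  [set T | bounded_operator T /\ forall S, A S -> T \o S = S \o T].

End Operators.

(* Unital *-subalgebras of B(H) equal to their bicommutant. That the carrier
   consists of bounded operators and is a unital subalgebra follows from
   [vn_bicommutant] (see the ring structure below). *)
Record vonNeumannAlgebra (R : realType) (H : hilbertSpace R) :=
  VonNeumannAlgebra {
  vn_carrier : set (H -> H);
  vn_adjoint : forall T, vn_carrier T -> exists2 S, vn_carrier S & is_adjoint T S;
  vn_bicommutant : commutant (commutant vn_carrier) = vn_carrier
}.

Definition vn_sort (R : realType) (H : hilbertSpace R)
  (M : vonNeumannAlgebra H) : Type := set_type (vn_carrier M).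
Coercion vn_sort : vonNeumannAlgebra >-> Sortclass.

Section VonNeumannRing.
Variables (R : realType) (H : hilbertSpace R) (M : vonNeumannAlgebra H).

Let memM T : (T \in vn_carrier M) <-> commutant (commutant (vn_carrier M)) T.
Proof. by rewrite vn_bicommutant inE. Qed.

Lemma bounded_operator0 : bounded_operator (0 : H -> H).
Proof.
split; first by move=> a x y; rewrite -[RHS]/(a *: 0 + 0) scaler0 addr0.
by move=> x; exact: cvg_cst.
Qed.

Lemma bounded_operatorP a (S T : H -> H) :
  bounded_operator S -> bounded_operator T -> bounded_operator (a *: S + T).
Proof.
move=> [Sl Sc] [Tl Tc]; split.
  move=> b x y; rewrite !fctE Sl Tl !scalerDr !scalerA (mulrC a b).
  by rewrite addrACA.
by move=> x; apply: continuousD; [apply: continuousZl_tmp; exact: Sc|exact: Tc].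
Qed.

Lemma bounded_operator1 : bounded_operator (@id H).
Proof. by split=> [a x y|x] //; exact: cvg_id. Qed.

Lemma bounded_operatorM (S T : H -> H) :
  bounded_operator S -> bounded_operator T -> bounded_operator (S \o T).
Proof.
move=> [Sl Sc] [Tl Tc]; split; first by move=> b x y; rewrite /= Tl Sl.
by move=> x; apply: continuous_comp; [exact: Tc|exact: Sc].
Qed.

Lemma vn_bounded T : T \in vn_carrier M -> bounded_operator T.
Proof. by case/memM. Qed.

Lemma vn_submod_closed : submod_closed [in vn_carrier M].
Proof.
split.
  apply/memM; split; first exact: bounded_operator0.
  move=> S [[Sl _] _]; apply/funext => x; rewrite -[LHS]/0 -[RHS]/(S 0).
  by have := Sl (-1) 0 0; rewrite scaler0 addr0 scaleN1r addNr => ->.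
move=> a S T /memM[Sb SC] /memM[Tb TC]; apply/memM.
split; first exact: bounded_operatorP.
move=> U UC; have [[Ul _] _] := UC; apply/funext => x.
rewrite -[LHS]/(a *: (S \o U) x + (T \o U) x) -[RHS]/(U (a *: S x + T x)).
by rewrite Ul SC// TC.
Qed.

Lemma vn_id : id \in vn_carrier M.
Proof. by apply/memM; split; [exact: bounded_operator1|]. Qed.

Lemma vn_comp S T : S \in vn_carrier M -> T \in vn_carrier M ->
  (S \o T) \in vn_carrier M.
Proof.
move=> /memM[Sb SC] /memM[Tb TC]; apply/memM.
split; first exact: bounded_operatorM.
by move=> U UC; rewrite -compA TC// compA SC// compA.
Qed.

HB.instance Definition _ := SubChoice.copy M (set_type (vn_carrier M)).
HB.instance Definition _ := GRing.SubChoice_isSubLmodule.Build R[i] (H -> H)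
  [in vn_carrier M] M vn_submod_closed.


Definition vn_one : M := exist _ id vn_id.

Definition vn_mul (a b : M) : M :=
  exist _ (val a \o val b) (vn_comp (valP a) (valP b)).

Fact vn_mulA : associative vn_mul.
Proof. by move=> a b c; exact: val_inj. Qed.

Fact vn_mul1r : left_id vn_one vn_mul.
Proof. by move=> a; exact: val_inj. Qed.

Fact vn_mulr1 : right_id vn_one vn_mul.
Proof. by move=> a; exact: val_inj. Qed.

Fact vn_mulDl : left_distributive vn_mul +%R.
Proof. by move=> a b c; exact: val_inj. Qed.

Fact vn_mulDr : right_distributive vn_mul +%R.
Proof.
move=> a b c; apply: val_inj; apply/funext => x /=.
have [al _] := vn_bounded (valP a).
by have := al 1 (val b x) (val c x); rewrite !scale1r.
Qed.

(* M is the zero ring when H = 0, whence pzRing rather than nzRing. *)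
HB.instance Definition _ := GRing.Zmodule_isPzRing.Build M
  vn_mulA vn_mul1r vn_mulr1 vn_mulDl vn_mulDr.

End VonNeumannRing.

Section VonNeumannNotions.
Variables (R : realType) (H : hilbertSpace R) (M : vonNeumannAlgebra H).

Definition vn_adj (a b : M) : Prop := is_adjoint (val a) (val b).

Definition projection (p : M) : Prop := p * p = p /\ vn_adj p p.

(* Since the order of R[i] only compares numbers with the same imaginary part,
   this includes that every <a x, x> is real. *)
Definition vn_positive (a : M) : Prop := forall x : H, 0 <= hdot H (val a x) x.

Definition vn_le (a b : M) : Prop := vn_positive (b - a).

(* Every isometry of M is unitary. *)
Definition vn_finite : Prop :=
  forall v w : M, vn_adj v w -> w * v = 1 -> v * w = 1.

Definition vn_sigma_finite : Prop :=
  forall P : set M,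
    (forall p, P p -> projection p /\ p <> 0) ->
    (forall p q, P p -> P q -> p <> q -> p * q = 0) ->
    countable P.

Definition directed_set (D : set M) : Prop :=
  D !=set0 /\
  forall a b, D a -> D b -> exists c, [/\ D c, vn_le a c & vn_le b c].

(* The order is only compared with elements above D; when D consists of
   positive elements these are automatically self-adjoint. *)
Definition is_supremum (D : set M) (s : M) : Prop :=
  (forall a, D a -> vn_le a s) /\
  (forall t, (forall a, D a -> vn_le a t) -> vn_le s t).

Definition normal_functional (tau : {scalar M}) : Prop :=
  forall (D : set M) (s : M),
    D `<=` vn_positive -> directed_set D -> is_supremum D s ->
    complex.Re (tau s) = sup [set complex.Re (tau a) | a in D].

Record faithful_normal_tracial_state (tau : {scalar M}) : Prop := {
  trace_positive : forall a, vn_positive a -> 0 <= tau a;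
  trace_tracial : forall a b, tau (a * b) = tau (b * a);
  trace_faithful : forall a, vn_positive a -> tau a = 0 -> a = 0;
  trace_normal : normal_functional tau;
  trace1 : tau 1 = 1
}.

End VonNeumannNotions.

Section Rank.
Variables (R : realType) (H : hilbertSpace R) (M : vonNeumannAlgebra H).
Variable tau : {scalar M}.

(* A right M-module is a left module over the converse ring M^c, so that the
   right action xi.a is written a *: xi. *)
Definition rank (E : lmodType M^c) (xi : E) : R :=
  1 - sup [set complex.Re (tau p) | p in
             [set p : M | projection p /\ (p : M^c) *: xi = 0]].

Definition rank_dist (E : lmodType M^c) (xi eta : E) : R := rank (xi - eta).

Definition rank_separated (E : lmodType M^c) : Prop :=
  forall xi eta : E, rank_dist xi eta = 0 -> xi = eta.

Definition rank_cauchy (E : lmodType M^c) (u : nat -> E) : Prop :=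
  forall e : R, 0 < e -> exists N : nat, forall m n : nat,
    (N <= m)%N -> (N <= n)%N -> rank_dist (u m) (u n) < e.

Definition rank_cvg (E : lmodType M^c) (u : nat -> E) (l : E) : Prop :=
  forall e : R, 0 < e -> exists N : nat, forall n : nat,
    (N <= n)%N -> rank_dist (u n) l < e.

(* rank_dist is always a pseudo-metric, so it is a metric as soon as it
   separates points. *)
Definition rank_complete (E : lmodType M^c) : Prop :=
  rank_separated E /\
  forall u : nat -> E, rank_cauchy u -> exists l : E, rank_cvg u l.

End Rank.

(* Main.v *)
(* A rank-complete E is a direct summand of every module F containing it. Take C
   maximal among the submodules of F that meet E trivially and let v be in F.
   The right ideal J = {a : va in E + C} is exhausted by increasing projections
   p_n with limit P. The components e_n in E of v p_n form a rank-Cauchy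
   sequence, and maximality of C places vP in E + C. Every nonzero right ideal of
   M contains a nonzero projection (spectral theory), so (1 - P)M meets J
   trivially, and maximality of C gives v(1 - P) in C. Hence F = E + C.
   The estimate behind the rank arguments is that, when pa = a, the kernel of a
   contains a projection of trace at least 1 - tau(p). *)
From HB Require Import structures.
Require Import Defs.
From mathcomp Require Import all_boot all_order all_algebra.
From mathcomp Require Import complex sesquilinear.
From mathcomp Require Import boolp classical_sets functions reals.
From mathcomp Require Import topology normedtype.
From mathcomp Require Import ring lra.

Set Implicit Arguments.
Unset Strict Implicit.
Unset Printing Implicit Defensive.

Import Order.TTheory GRing.Theory Num.Theory.
Local Open Scope ring_scope.
Local Open Scope complex_scope.

(** * Real inner product of a complex Hilbert space *)

(** A summand is enough because the extension is [phi] composed with the projection of F onto E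
    along C. The obstacle is that a projection killing v need not kill va, so that even continuity
    of the action for the rank rests on the trace, through the kernel estimate. Spectral theory is
    built from real polynomials in one self-adjoint operator: order relations are certified by
    polynomial identities exhibiting squares times positive factors, so that no square root occurs,
    and projections come from strong limits of such polynomials (powers for kernels, a sign
    iteration for spectral projections). The bicommutant property keeps these limits in M, and
    normality controls the trace along the monotone ones. *)

Section RealHilbert.
Variables (R : realType) (H : hilbertSpace R).
Implicit Types x y z : H.

(** Only the real part is kept, so that estimates take place in [R]; [Im_hdot] recovers the
    imaginary part. *)
Definition ip x y : R := complex.Re (hdot H x y).
Definition nrm x : R := complex.Re `|x|.

Lemma hdotC x y : hdot H x y = (hdot H y x)^*.
Proof. by rewrite hermC expr0 mul1r. Qed.

Lemma ipC x y : ip x y = ip y x.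
Proof. by rewrite /ip hdotC; case: (hdot H y x). Qed.

Lemma ipDl x y z : ip (x + y) z = ip x z + ip y z.
Proof. by rewrite /ip linearDl raddfD. Qed.

Lemma ipDr x y z : ip z (x + y) = ip z x + ip z y.
Proof. by rewrite ipC ipDl !(ipC z). Qed.

Lemma ipZl (r : R) x y : ip (r%:C *: x) y = r * ip x y.
Proof.
rewrite /ip linearZl_LR /=; case: (hdot H x y) => a b /=.
by rewrite mul0r subr0.
Qed.

Lemma ipZr (r : R) x y : ip x (r%:C *: y) = r * ip x y.
Proof. by rewrite ipC ipZl ipC. Qed.

Lemma ipNl x y : ip (- x) y = - ip x y.
Proof. by rewrite -(mulN1r (ip x y)) -ipZl rmorphN rmorph1 scaleN1r. Qed.

Lemma ipNr x y : ip y (- x) = - ip y x.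
Proof. by rewrite ipC ipNl ipC. Qed.

Lemma ipBl x y z : ip (x - y) z = ip x z - ip y z.
Proof. by rewrite ipDl ipNl. Qed.

Lemma ipBr x y z : ip z (x - y) = ip z x - ip z y.
Proof. by rewrite ipDr ipNr. Qed.

Lemma ip0l x : ip 0 x = 0.
Proof. by rewrite -(subrr x) ipBl subrr. Qed.

Lemma ip0r x : ip x 0 = 0.
Proof. by rewrite ipC ip0l. Qed.

Lemma Im_hdot x y : complex.Im (hdot H x y) = ip x ('i *: y).
Proof.
rewrite /ip [in RHS]hdotC linearZl_LR /= (hdotC x); case: (hdot H y x) => a b /=.
by rewrite mul0r mul1r sub0r.
Qed.

Lemma norm_nrm x : `|x| = (nrm x)%:C.
Proof. by rewrite RRe_real ?ger0_real. Qed.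

Lemma nrm_ge0 x : 0 <= nrm x.
Proof. by rewrite -ler0c -norm_nrm. Qed.

Lemma nrm_sqr x : nrm x ^+ 2 = ip x x.
Proof.
by apply: complexI; rewrite rmorphXn /= -norm_nrm hdot_norm /ip RRe_real //
  -hdot_norm rpredX // ger0_real.
Qed.

Lemma ip_ge0 x : 0 <= ip x x.
Proof. by rewrite -nrm_sqr sqr_ge0. Qed.

Lemma nrm_eq0 x : nrm x = 0 -> x = 0.
Proof. by move=> x0; apply/eqP; rewrite -normr_eq0 norm_nrm x0. Qed.

Lemma nrm0 : nrm 0 = 0.
Proof. by rewrite /nrm normr0. Qed.

Lemma ip_eq0 x : ip x x <= 0 -> x = 0.
Proof.
move=> x0; apply: nrm_eq0; apply/eqP; rewrite -sqrf_eq0 nrm_sqr.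
by rewrite eq_le x0 ip_ge0.
Qed.

Lemma nrmD x y : nrm (x + y) <= nrm x + nrm y.
Proof. by rewrite -lecR rmorphD /= -!norm_nrm ler_normD. Qed.

Lemma nrmN x : nrm (- x) = nrm x.
Proof. by rewrite /nrm normrN. Qed.

Lemma nrm_distC x y : nrm (x - y) = nrm (y - x).
Proof. by rewrite -nrmN opprB. Qed.

Lemma nrm_dist_add z x y : nrm (x - y) <= nrm (x - z) + nrm (z - y).
Proof. by rewrite (le_trans _ (nrmD _ _)) // addrA subrK. Qed.

Lemma nrmZ (r : R) x : nrm (r%:C *: x) = `|r| * nrm x.
Proof.
apply: complexI; rewrite -norm_nrm normrZ norm_nrm rmorphM /=; congr (_ * _).
by rewrite normc_def /= expr0n addr0 sqrtr_sqr.
Qed.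

Lemma nrm_le (c : R) x : 0 <= c -> ip x x <= c ^+ 2 -> nrm x <= c.
Proof. by move=> c0; rewrite -nrm_sqr ler_pXn2r ?nnegrE ?nrm_ge0. Qed.

Lemma cauchy_schwarz x y : ip x y <= nrm x * nrm y.
Proof.
have [->|y0] := eqVneq y 0; first by rewrite ip0r nrm0 mulr0.
have ny : 0 < nrm y.
  by rewrite lt_def nrm_ge0 andbT; apply: contra y0 => /eqP/nrm_eq0 ->.
(* The squared norm of [|y| x - |x| y] equals [2 |x| |y| (|x| |y| - <x, y>)]. *)
have := ip_ge0 ((nrm y)%:C *: x - (nrm x)%:C *: y).
rewrite !(ipBl, ipBr, ipZl, ipZr) -!nrm_sqr (ipC y x).
have := nrm_ge0 x; rewrite le_eqVlt => /predU1P[/esym/nrm_eq0 ->|nx].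
  by move=> _; rewrite ip0l nrm0 mul0r.
move=> h; rewrite -subr_ge0 -(pmulr_rge0 _ (mulr_gt0 nx ny)).
have -> : nrm x * nrm y * (nrm x * nrm y - ip x y) =
  (nrm y * (nrm y * nrm x ^+ 2 - nrm x * ip x y) -
   nrm x * (nrm y * ip x y - nrm x * nrm y ^+ 2)) / 2 by field.
by apply: divr_ge0 => //; nra.
Qed.

Definition hcvg (u : nat -> H) x :=
  forall e : R, 0 < e -> exists N, forall n, (N <= n)%N -> nrm (u n - x) < e.

Definition hcauchy (u : nat -> H) :=
  forall e : R, 0 < e -> exists N, forall m n, (N <= m)%N -> (N <= n)%N ->
    nrm (u m - u n) < e.

Lemma hcauchy_cvg u : hcauchy u -> exists x, hcvg u x.
Proof.
move=> uc.
have : cauchy (fmap u \oo)%classic.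
  apply/cauchy_ballP => e e0.
  have eE : e = (complex.Re e)%:C by rewrite RRe_real // gtr0_real.
  have [|N hN] := uc (complex.Re e).
    by move: e0; rewrite eE ltcR.
  exists (u @` [set n | (N <= n)%N], u @` [set n | (N <= n)%N])%classic.
    by split; exists N => // n /= Nn; exists n.
  move=> [_ _] [/= [m Nm <-] [n Nn <-]] /=.
  rewrite -ball_normE /ball_ /= norm_nrm eE ltcR; exact: hN.
move=> /cauchy_cvg/cvg_ex[x ux]; exists x => e e0.
have ux' : (u @ \oo --> x)%classic by [].
have [|N _ hN] := (cvgrPdist_lt _ _).1 ux' e%:C; first by rewrite ltcR.
by exists N => n Nn; have := hN n Nn; rewrite /= norm_nrm ltcR nrm_distC.
Qed.

Lemma hcvg_uniq u x y : hcvg u x -> hcvg u y -> x = y.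
Proof.
move=> ux uy; apply/eqP; rewrite -subr_eq0; apply/eqP/nrm_eq0/le_anti.
rewrite nrm_ge0 andbT; apply/ler_addgt0Pl => e e0.
have [N hN] := ux (e / 2) (divr_gt0 e0 (ltr0n _ 2)).
have [N' hN'] := uy (e / 2) (divr_gt0 e0 (ltr0n _ 2)).
have := nrm_dist_add (u (maxn N N')) x y; rewrite (nrm_distC x (u _)).
by have := hN _ (leq_maxl N N'); have := hN' _ (leq_maxr N N'); lra.
Qed.

Lemma hcvg_cst x : hcvg (fun=> x) x.
Proof. by move=> e e0; exists 0%N => n _; rewrite subrr nrm0. Qed.

Lemma hcvgD u v x y : hcvg u x -> hcvg v y -> hcvg (fun n => u n + v n) (x + y).
Proof.
move=> ux uy e e0.
have [N hN] := ux (e / 2) (divr_gt0 e0 (ltr0n _ 2)).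
have [N' hN'] := uy (e / 2) (divr_gt0 e0 (ltr0n _ 2)).
exists (maxn N N') => n; rewrite geq_max => /andP[/hN h1 /hN' h2].
by rewrite opprD addrACA (le_lt_trans (nrmD _ _)) //; lra.
Qed.

Lemma hcvgZ (z : R[i]) u x : hcvg u x -> hcvg (fun n => z *: u n) (z *: x).
Proof.
move=> ux e e0; pose c := complex.Re `|z|.
have zE : `|z| = c%:C by rewrite RRe_real ?ger0_real.
have c0 : 0 <= c by rewrite -lecR -zE normr_ge0.
have c1 : 0 < c + 1 by lra.
have [N hN] := ux (e / (c + 1)) (divr_gt0 e0 c1).
exists N => n /hN; rewrite -scalerBr ltr_pdivlMr // => h.
have -> : nrm (z *: (u n - x)) = c * nrm (u n - x).
  by apply: complexI; rewrite -norm_nrm normrZ norm_nrm zE rmorphM.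
by have := nrm_ge0 (u n - x); nra.
Qed.

Lemma hcvgS u x : hcvg u x -> hcvg (fun n => u n.+1) x.
Proof.
by move=> ux e /ux[N hN]; exists N => n Nn; apply: hN; exact: leqW.
Qed.

Lemma hcvg_le (c : R) u x : hcvg u x -> (forall n, nrm (u n) <= c) -> nrm x <= c.
Proof.
move=> ux uc; apply/ler_addgt0Pl => e /ux[N /(_ _ (leqnn N)) h].
have := nrmD (u N) (x - u N); rewrite addrC subrK (nrm_distC x).
by have := uc N; lra.
Qed.

Lemma hcvg_ip u x y : hcvg u x -> forall e : R, 0 < e ->
  exists N, forall n, (N <= n)%N -> `|ip (u n) y - ip x y| < e.
Proof.
move=> ux e e0; have d0 : 0 < nrm y + 1 by have := nrm_ge0 y; lra.
have [N hN] := ux _ (divr_gt0 e0 d0); exists N => n /hN.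
rewrite ltr_pdivlMr // -ipBl => h; have := cauchy_schwarz (u n - x) y.
have := cauchy_schwarz (- (u n - x)) y; rewrite ipNl nrmN ltr_norml.
by have := nrm_ge0 (u n - x); have := nrm_ge0 y => *; apply/andP; split; nra.
Qed.

Lemma hcvg_ip_ge (c : R) u x y :
  hcvg u x -> (forall n, c <= ip (u n) y) -> c <= ip x y.
Proof.
move=> ux uc; apply/ler_addgt0Pl => e e0.
have [N /(_ _ (leqnn N))] := hcvg_ip y ux e0.
by rewrite ltr_norml => /andP[_]; have := uc N; lra.
Qed.

Lemma hcvg_ip_le (c : R) u x y :
  hcvg u x -> (forall n, ip (u n) y <= c) -> ip x y <= c.
Proof.
move=> ux uc; apply/ler_addgt0Pl => e e0.
have [N /(_ _ (leqnn N))] := hcvg_ip y ux e0.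
by rewrite ltr_norml => /andP[+ _]; have := uc N; lra.
Qed.

(** The hypotheses make [g] nondecreasing and bounded, so once it is within [e^2] of its supremum
    all later increments stay below [e^2]. Every strong limit below comes from such a monotone
    quantity. *)
Lemma hcauchy_monotone (g : nat -> R) (B : R) u : (forall n, g n <= B) ->
  (forall m n, (n <= m)%N -> nrm (u m - u n) ^+ 2 <= g m - g n) -> hcauchy u.
Proof.
move=> gB gu e e0.
have hs : has_sup (range g).
  by split; [exists (g 0%N); exists 0%N | exists B => _ [n _ <-]].
have [_ [N _ <-] hN] := sup_adherent (exprn_gt0 2 e0) hs.
have main m n : (N <= n)%N -> (n <= m)%N -> nrm (u m - u n) < e.
  move=> Nn nm; rewrite -(@ltr_pXn2r _ 2) ?nnegrE ?nrm_ge0 ?ltW //.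
  apply: le_lt_trans (gu _ _ nm) _.
  have := ub_le_sup hs.2 (imageP g (I : setT m)); have := gu _ _ Nn.
  by have := sqr_ge0 (nrm (u n - u N)); lra.
exists N => m n Nm Nn; have [nm|/ltnW mn] := leqP n m; first exact: main.
by rewrite nrm_distC; exact: main.
Qed.

End RealHilbert.

(** * Operators and strong limits *)

Section Operators.
Variables (R : realType) (H : hilbertSpace R) (M : vonNeumannAlgebra H).
Implicit Types (a b c : M) (x y : H) (T : nat -> M).

Definition app a x : H := val a x.
Local Notation "a · x" := (app a x) (at level 41, right associativity).

Lemma vn_ext a b : (forall x, a · x = b · x) -> a = b.
Proof. by move=> ab; apply: val_inj; apply/funext. Qed.

Lemma appP a (z : R[i]) x y : a · (z *: x + y) = z *: (a · x) + a · y.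
Proof. by have [al _] := vn_bounded (valP a); exact: al. Qed.

Lemma app0 a : a · 0 = 0.
Proof. by have := appP a (-1) 0 0; rewrite scaler0 addr0 scaleN1r addNr. Qed.

Lemma appD a x y : a · (x + y) = a · x + a · y.
Proof. by have := appP a 1 x y; rewrite !scale1r. Qed.

Lemma appZ a (z : R[i]) x : a · (z *: x) = z *: (a · x).
Proof. by have := appP a z x 0; rewrite !addr0 app0 addr0. Qed.

Lemma appN a x : a · (- x) = - (a · x).
Proof. by rewrite -scaleN1r appZ scaleN1r. Qed.

Lemma app0l x : 0 · x = 0. Proof. by []. Qed.
Lemma app1l x : 1 · x = x. Proof. by []. Qed.
Lemma appDl a b x : (a + b) · x = a · x + b · x. Proof. by []. Qed.
Lemma appNl a x : (- a) · x = - (a · x). Proof. by []. Qed.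
Lemma appZl (z : R[i]) a x : (z *: a) · x = z *: (a · x). Proof. by []. Qed.
Lemma appMl a b x : (a * b) · x = a · (b · x). Proof. by []. Qed.

Definition appE := (app0, appD, appN, appZ, app0l, app1l, appDl, appNl, appZl, appMl).

Lemma vn_scalerAl (z : R[i]) a b : z *: a * b = z *: (a * b).
Proof. exact: vn_ext. Qed.

Lemma vn_scalerAr (z : R[i]) a b : a * (z *: b) = z *: (a * b).
Proof. by apply: vn_ext => x; rewrite !appE. Qed.

Lemma vn_adj_ip a b : vn_adj a b -> forall x y, ip (a · x) y = ip x (b · y).
Proof. by move=> ab x y; rewrite /ip ab. Qed.

Lemma vn_adjP a b : (forall x y, ip (a · x) y = ip x (b · y)) -> vn_adj a b.
Proof.
move=> ab x y; apply/eqP; rewrite eq_complex; apply/andP; split; apply/eqP.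
  exact: ab.
by rewrite !Im_hdot ab appZ.
Qed.

Lemma vn_adj_sym a b : vn_adj a b -> vn_adj b a.
Proof. by move=> ab; apply: vn_adjP => x y; rewrite ipC -(vn_adj_ip ab) ipC. Qed.

Lemma vn_adj_uniq a b c : vn_adj a b -> vn_adj a c -> b = c.
Proof.
move=> ab ac; apply: vn_ext => x; apply/eqP; rewrite -subr_eq0; apply/eqP.
apply: ip_eq0; rewrite ipBr -(vn_adj_ip ab) -(vn_adj_ip ac).
by rewrite subrr.
Qed.

Lemma vn_adj_ex a : exists b, vn_adj a b.
Proof.
have [S MS aS] := vn_adjoint (set_mem (valP a)).
by exists (exist _ S (mem_set MS)).
Qed.

Lemma vn_adjD a a' b b' : vn_adj a a' -> vn_adj b b' -> vn_adj (a + b) (a' + b').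
Proof.
by move=> aa bb; apply: vn_adjP => x y;
  rewrite !appE ipDl ipDr (vn_adj_ip aa) (vn_adj_ip bb).
Qed.

Lemma vn_adjN a a' : vn_adj a a' -> vn_adj (- a) (- a').
Proof.
by move=> aa; apply: vn_adjP => x y; rewrite !appE ipNl ipNr (vn_adj_ip aa).
Qed.

Lemma vn_adjB a a' b b' : vn_adj a a' -> vn_adj b b' -> vn_adj (a - b) (a' - b').
Proof. by move=> aa bb; apply: vn_adjD => //; exact: vn_adjN. Qed.

Lemma vn_adjM a a' b b' : vn_adj a a' -> vn_adj b b' -> vn_adj (a * b) (b' * a').
Proof.
by move=> aa bb; apply: vn_adjP => x y;
  rewrite !appE (vn_adj_ip aa) (vn_adj_ip bb).
Qed.

Lemma vn_adjZ (r : R) a a' : vn_adj a a' -> vn_adj (r%:C *: a) (r%:C *: a').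
Proof.
by move=> aa; apply: vn_adjP => x y; rewrite !appE ipZl ipZr (vn_adj_ip aa).
Qed.

Lemma vn_adj1 : vn_adj (1 : M) 1.
Proof. exact: vn_adjP. Qed.

Lemma vn_adj0 : vn_adj (0 : M) 0.
Proof. by apply: vn_adjP => x y; rewrite !appE ip0l ip0r. Qed.

Lemma vn_positiveP a : vn_adj a a -> (forall x, 0 <= ip (a · x) x) -> vn_positive a.
Proof.
move=> aa ap x; rewrite lecE ap andbT.
have : hdot H (a · x) x = (hdot H (a · x) x)^* by rewrite -hdotC aa.
rewrite -[val a x]/(a · x); case: (hdot H _ _) => u v [] /=.
by move=> vN; apply/eqP; lra.
Qed.

Lemma vn_positive_ip a : vn_positive a -> forall x, 0 <= ip (a · x) x.
Proof. by move=> ap x; have := ap x; rewrite lecE => /andP[]. Qed.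

Lemma app_bounded a : exists2 K : R, 0 < K & forall x, nrm (a · x) <= K * nrm x.
Proof.
have [al ac] := vn_bounded (valP a).
pose lin := GRing.isLinear.Build R[i] H H *:%R (val a) al.
pose f : {linear H -> H} := HB.pack (val a) lin.
have /linear_boundedP/pinfty_ex_gt0[K K0 aK] : bounded_near f (nbhs (0 : H)).
  exact/linear_bounded_continuous.
have KE : K = (complex.Re K)%:C by rewrite RRe_real // gtr0_real.
exists (complex.Re K); first by rewrite -ltcR -KE.
by move=> x; have := aK x; rewrite !norm_nrm KE -rmorphM /= lecR.
Qed.

Lemma hcvg_app a u x : hcvg u x -> hcvg (fun n => a · u n) (a · x).
Proof.
move=> ux e e0; have [K K0 aK] := app_bounded a.
have [N hN] := ux (e / K) (divr_gt0 e0 K0).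
exists N => n /hN; rewrite -appN -appD ltr_pdivlMr // mulrC.
exact: le_lt_trans.
Qed.

Definition slim T a := forall x, hcvg (fun n => T n · x) (a · x).

(** The pointwise limit is linear and bounded by [K]. Operators of the commutant are continuous and
    commute with each [T n], hence with the limit, which the bicommutant property then puts in
    [M]. *)
Lemma slim_ex T (K : R) : (forall n x, nrm (T n · x) <= K * nrm x) ->
  (forall x, hcauchy (fun n => T n · x)) ->
  exists2 a, slim T a & forall x, nrm (a · x) <= K * nrm x.
Proof.
move=> TK Tc; have /choice[t Tt] : forall x, exists y, hcvg (fun n => T n · x) y.
  by move=> x; exact: hcauchy_cvg.
have tl : linear t.
  move=> z x y; apply: hcvg_uniq (Tt _) _ => e e0.
  have [N hN] := hcvgD (hcvgZ z (Tt x)) (Tt y) e0.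
  by exists N => n /hN; rewrite !appE.
have tK x : nrm (t x) <= K * nrm x by exact: hcvg_le (Tt x) _.
have tc : continuous t.
  pose lin := GRing.isLinear.Build R[i] H H *:%R t tl.
  pose f : {linear H -> H} := HB.pack t lin.
  apply: (@bounded_linear_continuous _ _ _ f); apply/linear_boundedP.
  exists K%:C; split; first exact/complex_realP/ex_intro/erefl.
  move=> z Kz x; rewrite !norm_nrm /=.
  apply: le_trans (_ : K%:C * (nrm x)%:C <= _); first by rewrite -rmorphM /= lecR.
  by rewrite ler_wpM2r ?lecR ?nrm_ge0 // ltW.
have Mt : vn_carrier M t.
  rewrite -vn_bicommutant; split=> // U [[Ul Uc] UC]; apply/funext => x /=.
  pose lin := GRing.isLinear.Build R[i] H H *:%R U Ul.
  pose f : {linear H -> H} := HB.pack U lin.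
  have /linear_boundedP/pinfty_ex_gt0[C C0 fC] : bounded_near f (nbhs (0 : H)).
    exact/linear_bounded_continuous.
  have CE : C = (complex.Re C)%:C by rewrite RRe_real // gtr0_real.
  have {}C0 : 0 < complex.Re C by rewrite -ltcR -CE.
  apply: hcvg_uniq (Tt _) _ => e e0.
  have [N hN] := Tt x _ (divr_gt0 e0 C0); exists N => n /hN.
  have -> : T n · U x = U (T n · x).
    by have /(congr1 (fun g => g x)) := UC _ (set_mem (valP (T n))).
  have -> : U (T n · x) - U (t x) = f (T n · x - t x) by rewrite linearB.
  rewrite ltr_pdivlMr // mulrC; apply: le_lt_trans.
  by have := fC (T n · x - t x); rewrite !norm_nrm CE -rmorphM /= lecR.
by exists (exist _ t (mem_set Mt)).
Qed.

Lemma slim_adj T a : (forall n, vn_adj (T n) (T n)) -> slim T a -> vn_adj a a.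
Proof.
move=> Ts Ta; apply: vn_adjP => x y; apply/eqP.
rewrite -subr_eq0 -normr_le0; apply/ler_addgt0Pl => e e0; rewrite addr0.
have e2 : 0 < e / 2 by lra.
have [N hN] := hcvg_ip y (Ta x) e2; have [N' hN'] := hcvg_ip x (Ta y) e2.
have := hN _ (leq_maxl N N'); have := hN' _ (leq_maxr N N').
rewrite (vn_adj_ip (Ts _) x) (ipC x (a · y)) (ipC x (T _ · y)).
by rewrite !ltr_norml ler_norml => /andP[? ?] /andP[? ?]; apply/andP; split; lra.
Qed.

End Operators.
Local Notation "a · x" := (app a x) (at level 41, right associativity).

(** * Polynomials in a self-adjoint operator *)

Section PolynomialCalculus.
Variables (R : realType) (H : hilbertSpace R) (M : vonNeumannAlgebra H).
Variables (s : M) (s_adj : vn_adj s s).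
Implicit Types (p q : {poly R}) (a : M) (x : H).

(** Coefficients are real so that every value is self-adjoint ([ev_adj]). *)
Definition ev p : M := \sum_(i < size p) (p`_i)%:C *: s ^+ i.

Lemma ev_wide n p : (size p <= n)%N -> ev p = \sum_(i < n) (p`_i)%:C *: s ^+ i.
Proof.
move=> pn; rewrite /ev (big_ord_widen n (fun i => (p`_i)%:C *: s ^+ i)) //.
rewrite big_mkcond; apply: eq_bigr => i _; case: ltnP => // /(nth_default _) ->.
by rewrite scale0r.
Qed.

Lemma evD p q : ev (p + q) = ev p + ev q.
Proof.
rewrite !(@ev_wide (maxn (size p) (size q))) ?leq_maxl ?leq_maxr ?size_polyD //.
by rewrite -big_split; apply: eq_bigr => i _; rewrite coefD rmorphD scalerDl.
Qed.

Lemma evZ (r : R) p : ev (r *: p) = r%:C *: ev p.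
Proof.
rewrite (@ev_wide (size p)) ?size_scale_leq // scaler_sumr.
by apply: eq_bigr => i _; rewrite coefZ rmorphM scalerA.
Qed.

Lemma evN p : ev (- p) = - ev p.
Proof. by rewrite -scaleN1r evZ rmorphN rmorph1 scaleN1r. Qed.

Lemma evB p q : ev (p - q) = ev p - ev q.
Proof. by rewrite evD evN. Qed.

Lemma evC (r : R) : ev r%:P = r%:C *: (1 : M).
Proof.
by rewrite (@ev_wide 1) ?size_polyC_leq1 // big_ord1 coefC expr0.
Qed.

Lemma ev1 : ev 1 = 1.
Proof. by rewrite evC rmorph1 scale1r. Qed.

Lemma ev0 : ev 0 = 0.
Proof. by rewrite evC scale0r. Qed.

Lemma evMX p : ev (p * 'X) = ev p * s.
Proof.
have [->|p0] := eqVneq p 0; first by rewrite mul0r ev0 mul0r.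
rewrite /ev size_mulX // big_ord_recl coefMX eqxx scale0r add0r mulr_suml.
by apply: eq_bigr => i _; rewrite coefMX /= exprSr vn_scalerAl.
Qed.

Lemma evX : ev 'X = s.
Proof. by rewrite -['X]mul1r evMX ev1 mul1r. Qed.

Lemma evM p q : ev (p * q) = ev p * ev q.
Proof.
elim/poly_ind: q => [|q c IH]; first by rewrite mulr0 ev0 mulr0.
rewrite mulrDr evD mulrA evMX IH evD evMX evC mulrDr mulrA vn_scalerAr mulr1.
by rewrite mulrC mul_polyC evZ.
Qed.

Lemma evMC p q : ev p * ev q = ev q * ev p.
Proof. by rewrite -!evM mulrC. Qed.

Lemma ev_adj p : vn_adj (ev p) (ev p).
Proof.
elim/poly_ind: p => [|p c IH]; first by rewrite ev0; exact: vn_adj0.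
rewrite evD evC; apply: vn_adjD; last exact/vn_adjZ/vn_adj1.
by rewrite evMX {2}(_ : ev p * s = s * ev p); [exact: vn_adjM|rewrite -evX evMC].
Qed.

Definition pos p := forall x, 0 <= ip (ev p · x) x.

Lemma ip_ev p q x : ip (ev p · x) (ev q · x) = ip (ev (p * q) · x) x.
Proof. by rewrite mulrC evM appMl (vn_adj_ip (ev_adj q)). Qed.

Lemma nrm_ev p x : nrm (ev p · x) ^+ 2 = ip (ev (p * p) · x) x.
Proof. by rewrite nrm_sqr ip_ev. Qed.

Lemma posD p q : pos p -> pos q -> pos (p + q).
Proof. by move=> pp qp x; rewrite evD appDl ipDl addr_ge0. Qed.

Lemma posZ (r : R) p : 0 <= r -> pos p -> pos (r *: p).
Proof. by move=> r0 pp x; rewrite evZ appZl ipZl mulr_ge0. Qed.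

Lemma pos1 : pos 1.
Proof. by move=> x; rewrite ev1 ip_ge0. Qed.

Lemma pos_sqrM q p : pos p -> pos (q * q * p).
Proof.
move=> pp x; rewrite -mulrA (mulrC q p) evM appMl (vn_adj_ip (ev_adj q)) evM.
exact: pp.
Qed.

(** For general commuting positive factors a square root would be needed; here the identity in the
    proof leaves only squares times positive factors. *)
Lemma pos_mul1m p : pos p -> pos (1 - p) -> pos (p * (1 - p)).
Proof.
move=> pp p1; have -> : p * (1 - p) = p * p * (1 - p) + (1 - p) * (1 - p) * p by ring.
by apply: posD; exact: pos_sqrM.
Qed.

Lemma ev_contraction p x : pos p -> pos (1 - p) -> nrm (ev p · x) <= nrm x.
Proof.
move=> pp p1; apply: nrm_le (nrm_ge0 _) _.
rewrite ip_ev nrm_sqr (_ : p * p = 1 - (1 - p) - p * (1 - p)); last by ring.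
rewrite 2!evB ev1 !appE !ipBl.
by have := p1 x; have := pos_mul1m pp p1 x; lra.
Qed.

(** Splitting off the even part of the exponent leaves a square times [q] or [p * q]. *)
Lemma pos_exp q p n : pos q -> pos (p * q) -> pos (p ^+ n * q).
Proof.
move=> pq pp; rewrite -(odd_double_half n) addnC -addnn !exprD -mulrA.
by apply: pos_sqrM; case: odd; rewrite ?expr1 ?expr0 ?mul1r.
Qed.

Lemma pos_expB p m n : pos p -> pos (1 - p) -> (n <= m)%N -> pos (p ^+ n - p ^+ m).
Proof.
move=> pp p1; elim: m => [|m IH].
  by rewrite leqn0 => /eqP ->; rewrite subrr => x; rewrite ev0 ip0l.
rewrite leq_eqVlt => /predU1P[->|].
  by rewrite subrr => x; rewrite ev0 ip0l.
rewrite ltnS => /IH h.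
have -> : p ^+ n - p ^+ m.+1 = (p ^+ n - p ^+ m) + p ^+ m * (1 - p).
  by rewrite exprS; ring.
by apply: posD => //; apply: pos_exp => //; exact: pos_mul1m.
Qed.

(* r is the projection onto ker (1 - p). *)
Lemma ev_exp_slim p : pos p -> pos (1 - p) ->
  exists r : M, [/\ projection r, slim (fun n => ev (p ^+ n)) r & ev p * r = r].
Proof.
move=> pp p1; have p1n n : pos (p ^+ n).
  by rewrite -[_ ^+ _]mulr1; apply: pos_exp; rewrite ?mulr1 //; exact: pos1.
have pn1 n : pos (1 - p ^+ n) by have := pos_expB pp p1 (leq0n n).
have [|x|r rlim _] := @slim_ex _ _ _ (fun n => ev (p ^+ n)) 1.
- by move=> n x; rewrite mul1r; exact: ev_contraction.
(* The powers of [p] decrease; the identity below shows that the drops of the squared norm dominate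
   the squared distances. *)
- apply: (@hcauchy_monotone _ _ (fun n => - nrm (ev (p ^+ n) · x) ^+ 2) 0).
    by move=> n; rewrite oppr_le0 sqr_ge0.
  move=> m n nm; rewrite -appNl -appDl -evB !nrm_ev -subr_ge0.
  rewrite -!ipNl -!ipDl -!appNl -!appDl -!evN -!evD.
  have -> : - (p ^+ m * p ^+ m) - - (p ^+ n * p ^+ n) -
     (p ^+ m - p ^+ n) * (p ^+ m - p ^+ n) = 2 *: (p ^+ (n + m) - p ^+ (m + m)).
    by rewrite !exprD scaler_nat; ring.
  by apply: posZ => //; apply: pos_expB; rewrite ?leq_add2r.
have pr : ev p * r = r.
  apply: vn_ext => x; apply: (hcvg_uniq (hcvg_app (ev p) (rlim x))).
  move=> e /(hcvgS (rlim x))[N hN]; exists N => n /hN.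
  by rewrite -appMl -evM -exprS.
exists r; split=> //; split; last by apply: slim_adj rlim => n; exact: ev_adj.
apply: vn_ext => x; apply: (hcvg_uniq (rlim (r · x))) => e e0.
exists 0%N => n _; suff -> : ev (p ^+ n) · r · x = r · x by rewrite subrr nrm0.
elim: n => [|n IH]; first by rewrite ev1.
by rewrite exprSr evM appMl -(appMl (ev p)) pr IH.
Qed.

End PolynomialCalculus.

Section Intertwine.
Variables (R : realType) (H : hilbertSpace R) (M : vonNeumannAlgebra H).

(** Two operators are allowed so that, with [h = a' a] and [k = a a'], functions of [h] can be moved
    across [a]; the case [h = k] is commutation. *)
Lemma ev_intertwine (a h k : M) (P : {poly R}) :
  a * h = k * a -> a * ev h P = ev k P * a.
Proof.
move=> ahk; elim/poly_ind: P => [|P c IH]; first by rewrite !ev0 mulr0 mul0r.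
rewrite !evD !evMX !evC mulrDr mulrDl mulrA IH -!mulrA ahk.
by rewrite vn_scalerAr vn_scalerAl mulr1 mul1r.
Qed.

End Intertwine.

(** * The trace and kernel projections *)

Section ContractionSquares.
Variables (R : realType) (H : hilbertSpace R) (M : vonNeumannAlgebra H).
Implicit Types (a b : M) (x : H).

(** Divide [|bx|^2 = <x, abx> <= |x| |bx|] by [|bx|]. *)
Lemma adj_contraction a b : vn_adj a b -> (forall x, nrm (a · x) <= nrm x) ->
  forall x, nrm (b · x) <= nrm x.
Proof.
move=> ab ac x; have [->|x0] := eqVneq (b · x) 0; first by rewrite nrm0 nrm_ge0.
have n0 : 0 < nrm (b · x).
  by rewrite lt_def nrm_ge0 andbT; apply: contra x0 => /eqP/nrm_eq0 ->.
rewrite -(ler_pM2l n0) -expr2 nrm_sqr (vn_adj_ip (vn_adj_sym ab)) ipC.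
by apply: le_trans (cauchy_schwarz _ _) _; rewrite ler_wpM2r ?nrm_ge0.
Qed.

Lemma pos_adjM a b : vn_adj a b -> pos (b * a) 'X.
Proof. by move=> ab x; rewrite evX appMl (vn_adj_ip (vn_adj_sym ab)) ip_ge0. Qed.

Lemma pos_1B_adjM a b : vn_adj a b -> (forall x, nrm (a · x) <= nrm x) ->
  pos (b * a) (1 - 'X).
Proof.
move=> ab ac x; rewrite evB ev1 evX appDl appNl ipBl app1l appMl.
rewrite (vn_adj_ip (vn_adj_sym ab)) -!nrm_sqr subr_ge0.
by rewrite ler_pXn2r ?nnegrE ?nrm_ge0.
Qed.

End ContractionSquares.

Section Trace.
Variables (R : realType) (H : hilbertSpace R) (M : vonNeumannAlgebra H).
Variables (tau : {scalar M}) (tauM : faithful_normal_tracial_state tau).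
Implicit Types (a b p q : M) (x : H).

Definition tr a : R := complex.Re (tau a).

Lemma trD a b : tr (a + b) = tr a + tr b.
Proof. by rewrite /tr linearD raddfD. Qed.

Lemma trN a : tr (- a) = - tr a.
Proof. by rewrite /tr linearN raddfN. Qed.

Lemma trB a b : tr (a - b) = tr a - tr b.
Proof. by rewrite trD trN. Qed.

Lemma tr0 : tr 0 = 0.
Proof. by rewrite -(subrr 0) trB subrr. Qed.

Lemma tr1 : tr 1 = 1.
Proof. by rewrite /tr (trace1 tauM). Qed.

Lemma trC a b : tr (a * b) = tr (b * a).
Proof. by rewrite /tr (trace_tracial tauM). Qed.

Lemma tr_ge0 a : vn_positive a -> 0 <= tr a.
Proof. by move=> /(trace_positive tauM); rewrite lecE => /andP[]. Qed.

Lemma tr_le a b : vn_positive (b - a) -> tr a <= tr b.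
Proof. by move=> /tr_ge0; rewrite trB subr_ge0. Qed.

Lemma proj_adj p : projection p -> vn_adj p p. Proof. by case. Qed.

Lemma projK p : projection p -> p * p = p. Proof. by case. Qed.

Lemma proj0 : projection (0 : M).
Proof. by split; [rewrite mul0r|exact: vn_adj0]. Qed.

Lemma projC p : projection p -> projection (1 - p).
Proof.
move=> [pp pa]; split; last by apply: vn_adjB => //; exact: vn_adj1.
by rewrite mulrBr mulr1 mulrBl mul1r pp subrr subr0.
Qed.

Lemma projM_sym p q : projection p -> projection q -> p * q = 0 -> q * p = 0.
Proof.
move=> [_ pa] [_ qa] pq; apply: vn_adj_uniq (vn_adjM pa qa) _.
by rewrite pq; exact: vn_adj0.
Qed.

Lemma projM_abs p q : projection p -> projection q -> p * q = p -> q * p = p.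
Proof.
move=> [_ pa] [_ qa] pq; apply: vn_adj_uniq (vn_adjM pa qa) _.
by rewrite pq.
Qed.

Lemma projD p q : projection p -> projection q -> p * q = 0 -> projection (p + q).
Proof.
move=> pp qp pq; split; last exact: vn_adjD (proj_adj pp) (proj_adj qp).
by rewrite mulrDl !mulrDr pq (projM_sym pp qp pq) !projK // addr0 add0r.
Qed.

Lemma projB p q : projection p -> projection q -> p * q = p -> projection (q - p).
Proof.
move=> pp qp pq; split; last exact: vn_adjB (proj_adj qp) (proj_adj pp).
by rewrite mulrBl !mulrBr pq (projM_abs pp qp pq) !projK // subrr subr0.
Qed.

Lemma ip_proj p x : projection p -> ip (p · x) x = nrm (p · x) ^+ 2.
Proof.
by move=> [pp pa]; rewrite nrm_sqr [RHS](vn_adj_ip pa) -appMl pp ipC.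
Qed.

Lemma proj_positive p : projection p -> vn_positive p.
Proof.
move=> pp; apply: vn_positiveP (proj_adj pp) _ => x.
by rewrite ip_proj // sqr_ge0.
Qed.

Lemma tr_proj_ge0 p : projection p -> 0 <= tr p.
Proof. by move=> /proj_positive/tr_ge0. Qed.

Lemma tr_proj_le1 p : projection p -> tr p <= 1.
Proof. by move=> /projC/tr_proj_ge0; rewrite trB tr1 subr_ge0. Qed.

Lemma tr_proj_eq0 p : projection p -> tr p <= 0 -> p = 0.
Proof.
move=> pp p0; apply: (trace_faithful tauM (proj_positive pp)).
have t0 := trace_positive tauM (proj_positive pp).
have := ger0_Im t0; have := tr_proj_ge0 pp; move: p0; rewrite /tr.
by case: (tau p) => u v /= u0 u1 ->; congr (_ +i* _); apply/le_anti; rewrite u0 u1.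
Qed.

(** The strong limit of an increasing sequence of positive elements is the supremum of its range, a
    directed set, so normality applies. *)
Lemma tr_slim_le (T : nat -> M) (t : M) (c : R) :
  (forall n, vn_adj (T n) (T n)) -> (forall n x, 0 <= ip (T n · x) x) ->
  (forall m n x, (n <= m)%N -> ip (T n · x) x <= ip (T m · x) x) ->
  slim T t -> (forall n, tr (T n) <= c) -> tr t <= c.
Proof.
move=> Ta Tp Tm Tt Tc; have ta := slim_adj Ta Tt.
have Tpos n : vn_positive (T n) by apply: vn_positiveP.
have Tle x n : ip (T n · x) x <= ip (t · x) x.
  apply: (@hcvg_ip_ge _ _ _ (fun m => T (n + m)%N · x)).
    by move=> e /(Tt x)[N hN]; exists N => m Nm; apply: hN; exact: leq_trans (leq_addl _ _).
  by move=> m; apply: Tm; exact: leq_addr.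
have tpos : vn_positive t.
  by apply: vn_positiveP => // x; exact: le_trans (Tp 0%N x) (Tle x 0%N).
rewrite /tr (trace_normal tauM (D := range T)) //.
- apply: ge_sup => [|_ [_ [n _ <-] <-]]; last exact: Tc.
  by exists (tr (T 0%N)); exists (T 0%N) => //; exists 0%N.
- by move=> _ [n _ <-].
- split; first by exists (T 0%N); exists 0%N.
  move=> _ _ [m _ <-] [n _ <-]; exists (T (maxn m n)); split; first by exists (maxn m n).
    apply: vn_positiveP; first exact: vn_adjB.
    by move=> x; rewrite !appE ipBl subr_ge0; apply: Tm; exact: leq_maxl.
  apply: vn_positiveP; first exact: vn_adjB.
  by move=> x; rewrite !appE ipBl subr_ge0; apply: Tm; exact: leq_maxr.
split=> [_ [n _ <-]|u uT x].
  apply: vn_positiveP; first exact: vn_adjB.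
  by move=> x; rewrite !appE ipBl subr_ge0.
have uTn n : vn_positive (u - T n) by apply: uT; exists n.
(* Positivity of [u - t] includes a vanishing imaginary part. It is inherited from [u - T 0], since
   the forms of [T 0] and [t] are real. *)
rewrite lecE; apply/andP; split.
  rewrite -[val _ x]/(u · x - t · x) linearBl raddfB /= -[hdot H (t · x) x]/(hdot H (val t x) x).
  have := ger0_Im (uTn 0%N x); rewrite -[val _ x]/(u · x - T 0%N · x) linearBl raddfB /=.
  by rewrite (ger0_Im (Tpos 0%N x)) (ger0_Im (tpos x)) !subr0 => ->.
rewrite -[complex.Re (hdot _ _ _)]/(ip ((u - t) · x) x) !appE ipBl subr_ge0.
apply: hcvg_ip_le (Tt x) _ => n.
by have := vn_positive_ip (uTn n) x; rewrite !appE ipBl subr_ge0.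
Qed.

(* With a' the adjoint of a, traciality gives 1 - (1 - a'a)^n and 1 - (1 - aa')^n
   the same trace; the former increases to 1 - r, the latter is dominated by p. *)
Lemma kernel_proj a p : projection p -> p * a = a ->
  exists r, [/\ projection r, a * r = 0 & tr (1 - r) <= tr p].
Proof.
wlog ac : a / (forall x, nrm (a · x) <= nrm x).
  have [K K0 aK] := app_bounded a.
  move=> wl pp pa; have [|||r [rp ar rt]] := wl ((K^-1)%:C *: a).
  - move=> x; rewrite appE nrmZ gtr0_norm ?invr_gt0 //.
    by rewrite ler_pdivrMl // aK.
  - exact: pp.
  - by rewrite vn_scalerAr pa.
  exists r; split=> //; move: ar; rewrite vn_scalerAl => ar.
  rewrite -[a]scale1r -(rmorph1 (real_complex R)) -(divff (lt0r_neq0 K0)).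
  by rewrite rmorphM -scalerA !vn_scalerAl ar scaler0.
move=> pp pa; have [a' aa'] := vn_adj_ex a.
have a'a := vn_adj_sym aa'.
have a'c := adj_contraction aa' ac.
pose h := a' * a; pose k := a * a'; pose P := 1 - 'X : {poly R}.
have ha : vn_adj h h by exact: vn_adjM.
have ka : vn_adj k k by exact: vn_adjM.
have hX : pos h (1 - P) by rewrite subKr; exact: pos_adjM.
have h1 : pos h P by exact: pos_1B_adjM.
have kX : pos k (1 - P) by rewrite subKr; exact: pos_adjM.
have k1 : pos k P by exact: pos_1B_adjM.
have [r [rp rlim rE]] := ev_exp_slim ha h1 hX.
exists r; split=> //.
  have hr : h * r = 0.
    move: rE; rewrite evB ev1 evX mulrBl mul1r => rE.
    by rewrite -(subKr r (h * r)) rE subrr.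
  apply: vn_ext => x; apply: ip_eq0; rewrite appMl (vn_adj_ip aa').
  by rewrite -[a' · a · r · x]/((h * r) · x) hr ip0r.
(* Divisibility by ['X] exposes the factor [h = a' a], so that [tr (a' a Q(h)) = tr (a Q(h) a') = tr
   (Q(k) a a')]. *)
have PX n : exists Q, 1 - P ^+ n = 'X * Q.
  elim: n => [|n [Q hQ]]; first by exists 0; rewrite subrr mulr0.
  by exists (Q * P + 1); rewrite mulrDr mulrA -hQ exprSr /P; ring.
apply: (@tr_slim_le (fun n => ev h (1 - P ^+ n))).
- by move=> n; exact: ev_adj.
- by move=> n; exact: (pos_expB ha h1 hX (leq0n n)).
- move=> m n x nm; rewrite -subr_ge0 -ipBl -appNl -appDl -evB.
  have -> : 1 - P ^+ m - (1 - P ^+ n) = P ^+ n - P ^+ m by ring.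
  exact: (pos_expB ha h1 hX nm).
- move=> x e e0; have [N hN] := rlim x e e0; exists N => n /hN.
  rewrite nrm_distC evB ev1 !appE; congr (nrm _ < _).
  by rewrite opprB [RHS]addrC addrA subrK.
move=> n; have [Q QE] := PX n.
have -> : tr (ev h (1 - P ^+ n)) = tr (ev k (1 - P ^+ n)).
  rewrite QE [in LHS]evM evX -mulrA trC (@ev_intertwine _ _ _ a h k) ?mulrA //.
  by rewrite -mulrA -/k mulrC evM evX.
set g := ev k _.
have pg : p * g = g by rewrite /g QE evM evX /k !mulrA pa.
have gp : g * p = g.
  apply: (vn_adj_uniq (vn_adjM (proj_adj pp) (ev_adj ka (1 - P ^+ n)))).
  by rewrite -/g pg; exact: ev_adj.
(* [1 - g] is the power [P ^+ n] at [k], hence positive, and its compression by [p] stays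
   positive. *)
apply: tr_le; have -> : p - g = p * (1 - g) * p.
  by rewrite mulrBr mulr1 mulrBl pg gp projK.
apply: vn_positiveP => [|x].
  rewrite -{2}mulrA; apply: (vn_adjM (vn_adjM (proj_adj pp) _) (proj_adj pp)).
  by apply: vn_adjB; [exact: vn_adj1|exact: ev_adj].
rewrite appMl appMl (vn_adj_ip (proj_adj pp)) /g -(ev1 k) -evB subKr.
rewrite -[P ^+ n]mulr1; apply: (pos_exp ka); first exact: pos1.
by rewrite mulr1.
Qed.

End Trace.

(** * Projections in right ideals *)

Section SignIteration.
Variables (R : realType) (H : hilbertSpace R) (M : vonNeumannAlgebra H).
Implicit Types (a b c u : M) (x : H) (S T : nat -> M).

Lemma slimM S T a b (K : R) : (forall n x, nrm (S n · x) <= K * nrm x) ->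
  slim S a -> slim T b -> slim (fun n => S n * T n) (a * b).
Proof.
move=> SK Sa Tb x e e0.
have K1 : 0 < `|K| + 1 by have := normr_ge0 K; lra.
have d0 : 0 < e / 2 / (`|K| + 1) by rewrite !divr_gt0.
have [N hN] := Tb x _ d0.
have [N' hN'] := Sa (b · x) _ (divr_gt0 e0 (ltr0n _ 2)).
exists (maxn N N') => n; rewrite geq_max => /andP[/hN h /hN' h'].
rewrite !appMl; apply: le_lt_trans (nrm_dist_add (S n · b · x) _ _) _.
rewrite -appN -appD; move: h; rewrite ltr_pdivlMr // => h.
have := SK n (T n · x - b · x); have := nrm_ge0 (T n · x - b · x).
by have := ler_norm K; nra.
Qed.

(** The partial sums of the Neumann series obey [T n.+1 = 1 + u * T n]; the limit is a fixed point
    of this recursion, that is, a right inverse of [1 - u]. *)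
Lemma neumann u (m : R) : 0 <= m < 1 -> (forall x, nrm (u · x) <= m * nrm x) ->
  exists c, (1 - u) * c = 1.
Proof.
move=> /andP[m0 m1] um; pose T n : M := iter n (fun t => 1 + u * t) 0.
have T1 n x : nrm (T n.+1 · x - T n · x) <= m ^+ n * nrm x.
  elim: n => [|n IH]; first by rewrite /T /= !appE addr0 subr0 expr0 mul1r.
  rewrite [T n.+2]/(1 + u * T n.+1) [in X in _ - X]/(T n.+1) /= -/(T n).
  rewrite !appDl !appMl opprD addrACA subrr add0r -appN -appD exprS -mulrA.
  by apply: le_trans (um _) _; rewrite ler_wpM2l.
have Tmn k n x : (1 - m) * nrm (T (n + k)%N · x - T n · x) <=
    (m ^+ n - m ^+ (n + k)) * nrm x.
  elim: k => [|k IH]; first by rewrite addn0 !subrr nrm0 mulr0 mul0r.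
  have := nrm_dist_add (T (n + k)%N · x) (T (n + k.+1)%N · x) (T n · x).
  rewrite addnS; have := T1 (n + k)%N x; rewrite exprS; nra.
have m10 : 0 < 1 - m by lra.
have [|x|c cT _] := @slim_ex _ _ _ T (1 - m)^-1.
- move=> n x; rewrite [leRHS]mulrC ler_pdivlMr // mulrC.
  have := Tmn n 0%N x; rewrite add0n appE subr0 expr0 => /le_trans; apply.
  by have := nrm_ge0 x; have := exprn_ge0 n m0; nra.
(* Distances are at most [C * B] with [B] an increment of [- m ^+ n]. As [B <= 1], their squares are
   at most [C ^+ 2 * B], the form that [hcauchy_monotone] expects. *)
- pose C := nrm x / (1 - m).
  have C0 : 0 <= C by rewrite divr_ge0 ?nrm_ge0 // ltW.
  apply: (@hcauchy_monotone _ _ (fun n => - (C ^+ 2 * m ^+ n)) 0).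
    by move=> n; rewrite oppr_le0 mulr_ge0 ?exprn_ge0.
  move=> k n /subnKC <-; set d := (k - n)%N.
  have h : nrm (T (n + d)%N · x - T n · x) <= C * (m ^+ n - m ^+ (n + d)).
    by rewrite /C mulrAC ler_pdivlMr // [leLHS]mulrC [leRHS]mulrC; exact: Tmn.
  have n0 := nrm_ge0 (T (n + d)%N · x - T n · x).
  have mn1 : m ^+ n <= 1 by rewrite exprn_ile1 // ltW.
  have mnd := exprn_ge0 (n + d) m0.
  set D := nrm _ in h n0 *; set B := m ^+ n - _ in h.
  have B1 : B <= 1 by rewrite /B; lra.
  rewrite opprK addrC -mulrBr -/B expr2; apply: le_trans (_ : C * (C * B) <= _); last first.
    by rewrite expr2 mulrA.
  apply: ler_pM => //; apply: le_trans h _.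
  by rewrite ler_piMr.
exists c; rewrite mulrBl mul1r; apply/eqP; rewrite subr_eq; apply/eqP.
apply: vn_ext => x; apply: (hcvg_uniq (hcvgS (cT x))).
exact: hcvgD (hcvg_cst x) (hcvg_app u (cT x)).
Qed.

(* The Newton-Schulz iteration s_(n+1) = (3 s_n - s_n^3) / 2 for the sign of s,
   in the form s_n = s w_n(y) with y = 1 - s^2 and 1 - s_n^2 = y_n(y): the
   polynomials w_n and y_n have nonnegative coefficients, which gives all
   the positivity needed for convergence. *)
Let half : {poly R} := (2^-1)%:P.

(** Stated as a vanishing factor: [ring] reduces the identities below to multiples of
    [1 - 2 * half]. *)
Let halfE : 1 - 2 * half = 0.
Proof. by rewrite /half -(polyC_natr R 2) -polyCM mulfV ?pnatr_eq0 // subrr. Qed.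

(** As [s_n^2 = 1 - y_n], the step multiplies [s_n] by [(3 - s_n^2) / 2 = 1 + y_n / 2], and [1 - (1
    - y_n) (1 + y_n / 2)^2 = y_n^2 (3 + y_n) / 4]. The variable ['X] stands for [y = 1 - s^2], not
    for [s]. *)
Definition ns_step (wy : {poly R} * {poly R}) :=
  (wy.1 * (1 + half * wy.2), half * half * (wy.2 * wy.2 * (3 + wy.2))).

Definition ns n := iter n ns_step (1, 'X).

Lemma ns_eq n : 1 - (1 - 'X) * ((ns n).1 * (ns n).1) = (ns n).2.
Proof.
elim: n => [|n]; first by rewrite /= !mulr1 subKr.
rewrite [ns n.+1]/(ns_step (ns n)) /ns_step /=; move: (ns n) => [w y] /= IH.
have wE : (1 - 'X) * (w * w) = 1 - y by rewrite -IH; ring.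
have -> : (1 - 'X) * (w * (1 + half * y) * (w * (1 + half * y))) =
  (1 - 'X) * (w * w) * ((1 + half * y) * (1 + half * y)) by ring.
rewrite wE; apply/eqP; rewrite -subr_eq0; apply/eqP.
transitivity ((1 - 2 * half) * (y + 2 * half * (y * y))); first by ring.
by rewrite halfE mul0r.
Qed.

(** Closed under sums and products by inspection, and turned into operator positivity by
    [pos_comp]. *)
Definition nneg_coef (P : {poly R}) := forall i, 0 <= P`_i.

Lemma nneg_coefD P Q : nneg_coef P -> nneg_coef Q -> nneg_coef (P + Q).
Proof. by move=> p q i; rewrite coefD addr_ge0. Qed.

Lemma nneg_coefM P Q : nneg_coef P -> nneg_coef Q -> nneg_coef (P * Q).
Proof. by move=> p q i; rewrite coefM sumr_ge0 // => j _; rewrite mulr_ge0. Qed.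

Lemma nneg_coefC (r : R) : 0 <= r -> nneg_coef r%:P.
Proof. by move=> r0 i; rewrite coefC; case: ifP. Qed.

Let nneg_half : nneg_coef half.
Proof. by apply: nneg_coefC; rewrite invr_ge0. Qed.

Lemma ns_nneg n : nneg_coef (ns n).1 /\ nneg_coef (ns n).2.
Proof.
elim: n => [|n [w y]].
  by split=> i /=; [rewrite coef1|rewrite coefX]; exact: ler0n.
rewrite [ns n.+1]/(ns_step (ns n)) /ns_step /=; split.
  apply: nneg_coefM => //; rewrite -polyC1; apply: nneg_coefD; first exact: nneg_coefC.
  exact: nneg_coefM.
apply: nneg_coefM; first exact: nneg_coefM.
apply: nneg_coefM; first exact: nneg_coefM.
by rewrite -polyC_natr; apply: nneg_coefD => //; exact: nneg_coefC.
Qed.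

Lemma ns_nnegB m n : (n <= m)%N -> nneg_coef ((ns m).1 - (ns n).1).
Proof.
have nn k : nneg_coef ((ns k).1 - (ns k).1) by move=> i; rewrite subrr coef0.
elim: m => [|m IH]; first by rewrite leqn0 => /eqP ->.
rewrite leq_eqVlt => /predU1P[->|] //.
rewrite ltnS => /IH h; have [w y] := ns_nneg m.
rewrite [ns m.+1]/(ns_step (ns m)) /ns_step /=.
have -> : (ns m).1 * (1 + half * (ns m).2) - (ns n).1 =
  ((ns m).1 - (ns n).1) + (ns m).1 * (half * (ns m).2) by ring.
by apply: nneg_coefD => //; do 2!apply: nneg_coefM => //.
Qed.

Section Sign.
Variables (s : M) (s_adj : vn_adj s s) (s1 : pos s (1 - 'X * 'X)).
Let Y : {poly R} := 1 - 'X * 'X.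

Lemma pos_comp P : nneg_coef P -> pos s (P \Po Y).
Proof.
move=> P0; rewrite comp_polyE.
elim/big_ind: _ => [x||i _]; first by rewrite ev0 ip0l.
  exact: posD.
apply: posZ => //.
by rewrite -[_ ^+ _]mulr1; apply: (pos_exp s_adj); [exact: pos1|rewrite mulr1].
Qed.

Let sn n := 'X * ((ns n).1 \Po Y).

Let sn_sqr n : 1 - sn n * sn n = (ns n).2 \Po Y.
Proof.
rewrite -ns_eq !(comp_polyB, comp_polyM, comp_polyX) comp_polyC /sn /Y polyC1.
by ring.
Qed.

Let snS n : sn n.+1 = half * (3 * sn n - sn n * sn n * sn n).
Proof.
rewrite /sn [ns n.+1]/(ns_step (ns n)) /ns_step /=.
rewrite !(comp_polyD, comp_polyM) -sn_sqr !comp_polyC polyC1 -/half /sn.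
apply/eqP; rewrite -subr_eq0; apply/eqP; move: ((ns n).1 \Po Y) => w.
transitivity ((1 - 2 * half) * ('X * w)); first by ring.
by rewrite halfE mul0r.
Qed.

(** The sign vanishes on the kernel of [s], hence [g^3 = g] instead of [g^2 = 1]. The last clause is
    [s^2 <= |s|], with [g s] in the role of [|s|]; it ties [g] to the sign of [s]. *)
Lemma sign_ex : exists g : M, [/\ vn_adj g g, g * g * g = g,
  forall a, a * s = s * a -> a * g = g * a &
  forall x, ip (s · x) (s · x) <= ip (g · s · x) x].
Proof.
have snc n x : nrm (ev s (sn n) · x) <= 1 * nrm x.
  rewrite mul1r; apply: nrm_le (nrm_ge0 _) _.
  rewrite (ip_ev s_adj) nrm_sqr -subr_ge0.
  have [_ /pos_comp/(_ x)] := ns_nneg n.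
  by rewrite -sn_sqr evB ev1 appDl appNl ipBl.
have [x|g glim _] := slim_ex snc.
  apply: (@hcauchy_monotone _ _ (fun n => nrm (ev s (sn n) · x) ^+ 2) (nrm x ^+ 2)).
    by move=> n; rewrite ler_pXn2r ?nnegrE ?nrm_ge0 // -[nrm x]mul1r.
  move=> m n nm; rewrite -appNl -appDl -evB !(nrm_ev s_adj) -subr_ge0.
  rewrite -!ipNl -!ipDl -!appNl -!appDl -!evN -!evD.
  (* Both sides are [2 s_n (s_m - s_n)], and [s_n = s w_n] makes this [s^2] times a polynomial in
     [y] with nonnegative coefficients. *)
  have -> : sn m * sn m - sn n * sn n - (sn m - sn n) * (sn m - sn n) =
     2 *: ('X * 'X * (((ns n).1 * ((ns m).1 - (ns n).1)) \Po Y)).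
    by rewrite comp_polyM comp_polyB scaler_nat /sn; ring.
  apply: posZ => //; apply: (pos_sqrM s_adj); apply: pos_comp.
  by have [w _] := ns_nneg n; apply: nneg_coefM => //; exact: ns_nnegB.
exists g; split.
- by apply: slim_adj glim => n; exact: ev_adj.
- have lim3 := slimM snc glim (slimM snc glim glim).
  apply: vn_ext => x; apply/esym.
  (* The limit of the recursion: [g = (3 g - g^3) / 2]. *)
  have gE : g · x = (2^-1)%:C *: (3%:C *: (g · x) + (-1) *: (g * (g * g)) · x).
    apply: (hcvg_uniq (hcvgS (glim x))).
    have := hcvgZ (2^-1)%:C (hcvgD (hcvgZ 3%:C (glim x)) (hcvgZ (-1) (lim3 x))).
    move=> h e /h[N hN]; exists N => n /hN; rewrite snS; congr (nrm (_ - _) < _).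
    rewrite mul_polyC evZ evB appZl; congr (_ *: _).
    by rewrite -mulrA -polyC_natr mul_polyC evZ !evM appDl appNl scaleN1r.
  have h2 : 2%:C * (2^-1)%:C = 1 :> R[i] by rewrite -rmorphM mulfV ?pnatr_eq0 // rmorph1.
  move: gE => /(congr1 (fun z => 2%:C *: z)); rewrite scalerA h2 scale1r appZl scaleN1r => gE.
  rewrite -mulrA -[RHS](subKr (3%:C *: (g · x))) -gE -scalerBl -rmorphB.
  by rewrite (_ : 3 - 2 = 1) ?rmorph1 ?scale1r //; lra.
- move=> a as_; apply: vn_ext => x; rewrite !appMl.
  apply: (hcvg_uniq (hcvg_app a (glim x))) => e /(glim (a · x))[N hN].
  by exists N => n /hN; rewrite -!appMl (ev_intertwine _ as_).
(* The inequality holds at every [n], because [s_n s - s^2 = s^2 (w_n - w_0)] with [w_0 = 1]. *)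
move=> x; apply: (hcvg_ip_ge (glim (s · x))) => n.
have -> : ip (s · x) (s · x) = ip (ev s ('X * 'X) · x) x by rewrite -(ip_ev s_adj) evX.
have -> : ev s (sn n) · s · x = ev s (sn n * 'X) · x by rewrite evM evX.
rewrite -subr_ge0 -ipBl -appNl -appDl -evB.
have -> : sn n * 'X - 'X * 'X = 'X * 'X * (((ns n).1 - (ns 0).1) \Po Y).
  by rewrite comp_polyB comp_polyC polyC1 /sn; ring.
by apply: (pos_sqrM s_adj); apply: pos_comp; exact: ns_nnegB.
Qed.

End Sign.

End SignIteration.

(** * Spectral projections and projections in [aM] *)

Section SpectralProjection.
Variables (R : realType) (H : hilbertSpace R) (M : vonNeumannAlgebra H).
Implicit Types (a b c u : M) (x : H).

(* e is the spectral projection of h for (eps, oo): it is (g^2 + g) / 2 with g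
   the sign of s = h - eps. *)
Lemma spectral_proj (h : M) (eps : R) : vn_adj h h -> pos h 'X -> pos h (1 - 'X) ->
  0 < eps <= 2^-1 -> (exists x, eps * ip x x < ip (h · x) x) ->
  exists e, [/\ projection e, e != 0, e * h = h * e &
    forall x, eps * ip (e · x) x <= ip (e * h · x) x].
Proof.
move=> ha hX h1 /andP[e0 e2] [x0 hx0].
pose s := ev h ('X - eps%:P).
have sE : s = h - eps%:C *: (1 : M) by rewrite /s evB evX evC.
have sa : vn_adj s s by exact: ev_adj.
have s1 : pos s (1 - 'X * 'X).
  move=> x; rewrite evB ev1 evM evX.
  have -> : 1 - s * s = ev h (1 - ('X - eps%:P) * ('X - eps%:P)) by rewrite evB ev1 evM.
  (* With [p = (1 + s) / 2], the factorization [1 - s^2 = (1 + s) (1 - s) = 4 p (1 - p)] reduces the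
     claim to [pos_mul1m]. *)
  pose c : {poly R} := (2^-1)%:P; pose p := c * (1 - eps%:P + 'X).
  have cE : 2 * c = 1.
    by rewrite /c -(polyC_natr R 2) -polyCM mulfV ?pnatr_eq0.
  have pp : pos h p.
    rewrite /p /c mul_polyC; apply: posZ; first by rewrite invr_ge0.
    apply: posD hX; rewrite -[_ - _]mulr1 -polyC1 -polyCB mul_polyC polyC1.
    by apply: posZ (pos1 _); lra.
  have p1 : pos h (1 - p).
    have -> : 1 - p = c * (eps%:P + (1 - 'X)).
      by transitivity (2 * c - p); [rewrite cE|rewrite /p; ring].
    rewrite /c mul_polyC; apply: posZ; first by rewrite invr_ge0.
    apply: posD h1; rewrite -[X in pos _ X]mulr1 mul_polyC.
    by apply: posZ (pos1 _); lra.
  have -> : 1 - ('X - eps%:P) * ('X - eps%:P) = 4 *: (p * (1 - p)).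
    rewrite -mul_polyC polyC_natr.
    transitivity ((2 * c) * (2 - 2 * c) - (2 * c) * (2 * c) * (('X - eps%:P) * ('X - eps%:P))
      + (2 * c) * (2 - 2 * (2 * c)) * ('X - eps%:P)).
      by rewrite cE; ring.
    by rewrite /p; ring.
  by apply: posZ => //; exact: pos_mul1m.
have [g [ga g3 gC gs]] := sign_ex sa s1.
have sgC : g * s = s * g by rewrite -gC.
pose c : {poly R} := (2^-1)%:P.
have cE : 2 * c = 1 by rewrite /c -(polyC_natr R 2) -polyCM mulfV ?pnatr_eq0.
have X3 : ev g ('X * 'X * 'X - 'X) = 0 by rewrite evB !evM evX g3 subrr.
(* On the roots -1, 0, 1 of ['X^3 - 'X], the polynomial [q] is the indicator of 1; thus [q * 'X - q]
   and [q * q - q] are multiples of ['X^3 - 'X]. *)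
pose q := c * ('X * 'X + 'X); pose e := ev g q.
have eg : e * g = e.
  apply/eqP; rewrite -subr_eq0 -[X in _ * X](evX g) -evM -evB.
  have -> : q * 'X - q = c * ('X * 'X * 'X - 'X) by rewrite /q; ring.
  by rewrite evM X3 mulr0.
have ge : g * e = e by rewrite -[X in X * _](evX g) evMC evX.
have ee : e * e = e.
  have qq : q * q = q + (c * c * ('X + 2)) * ('X * 'X * 'X - 'X).
    transitivity (q + (c * c * ('X + 2)) * ('X * 'X * 'X - 'X)
      + (2 * c - 1) * c * ('X * 'X + 'X)); first by rewrite /q; ring.
    by rewrite cE subrr !mul0r addr0.
  by rewrite /e -evM qq evD [ev g (_ * ('X * 'X * 'X - 'X))]evM X3 mulr0 addr0.
have ep : projection e by split=> //; exact: ev_adj.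
have es : e * s = s * e by rewrite /e -(@ev_intertwine _ _ _ s g g) // sgC.
have eh : e * h = h * e.
  move: es; rewrite sE mulrBr mulrBl vn_scalerAr vn_scalerAl mulr1 mul1r.
  exact: addIr.
(* Since [e g = e], [e s] is the compression by [e] of [g s], which dominates [s^2]. *)
have epos x : 0 <= ip (e * s · x) x.
  have -> : e * s = e * (g * s) * e.
    by rewrite [e * (g * s)]mulrA eg es -mulrA ee.
  rewrite !appMl (vn_adj_ip (proj_adj ep)) -appMl.
  by apply: le_trans (gs _); exact: ip_ge0.
exists e; split=> //.
  (* If [e = 0] then [g^2 = - g], which forces [s = - g s <= 0], against the choice of [x0]. *)
  apply/eqP => eE0; move: hx0; apply/negP; rewrite -leNgt.
  have gg : g * g = - g.
    apply/eqP; rewrite -addr_eq0 -[X in _ + X](evX g) -[X in X * X](evX g) -evM -evD.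
    rewrite -[_ + _]mul1r -cE -mulrA evM -/q.
    by rewrite -/e eE0 mulr0.
  have sg0 x : s · (1 + g) · x = 0.
    apply: ip_eq0; apply: le_trans (gs _) _.
    rewrite -appMl sgC appMl -[g · _ · x]appMl mulrDr mulr1 gg subrr.
    by rewrite app0l app0 ip0l.
  have : ip (s · x0) x0 <= 0.
    have := sg0 x0; rewrite appDl app1l appD => /eqP; rewrite addr_eq0 => /eqP ->.
    rewrite ipNl oppr_le0 -appMl -sgC appMl.
    exact: le_trans (ip_ge0 _) (gs _).
  by rewrite sE !appE ipBl ipZl subr_le0.
move=> x; have := epos x; rewrite sE mulrBr vn_scalerAr mulr1 appDl appNl ipBl.
by rewrite appZl ipZl subr_ge0.
Qed.

(** With [b] the adjoint of [a] and [h = a b], some spectral projection [e] of [h] is nonzero and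
    [h] is bounded below on it. Inverting [h] there gives [e = h e c = a (b e c)]. *)
Lemma right_ideal_proj a : a != 0 ->
  exists c, projection (a * c) /\ a * c != 0.
Proof.
wlog ac : a / (forall x, nrm (a · x) <= nrm x).
  have [K K0 aK] := app_bounded a.
  move=> wl a0; have [||c] := wl ((K^-1)%:C *: a).
  - move=> x; rewrite appE nrmZ gtr0_norm ?invr_gt0 //.
    by rewrite ler_pdivrMl // aK.
  - apply: contra_neq a0 => /(congr1 (fun b => K%:C *: b)).
    by rewrite scalerA -rmorphM mulfV ?lt0r_neq0 // rmorph1 scale1r scaler0.
  by rewrite vn_scalerAl -vn_scalerAr; exists ((K^-1)%:C *: c).
move=> a0; have [b ab] := vn_adj_ex a; have ba := vn_adj_sym ab.
have bc := adj_contraction ab ac; pose h := a * b.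
have ha : vn_adj h h by exact: vn_adjM.
have hX : pos h 'X by exact: pos_adjM.
have h1 : pos h (1 - 'X) by exact: pos_1B_adjM.
have [x0 bx0] : exists x, b · x != 0.
  apply: contrapT => /forallNP b0; case/eqP: a0; apply: vn_adj_uniq ba _.
  rewrite (_ : b = 0); first exact: vn_adj0.
  by apply: vn_ext => x; apply/eqP/negPn/negP; exact: b0.
have hb x : ip (h · x) x = nrm (b · x) ^+ 2.
  by rewrite appMl (vn_adj_ip ab) nrm_sqr.
have d0 : 0 < ip (h · x0) x0.
  by rewrite hb exprn_gt0 // lt_def nrm_ge0 andbT; apply: contra bx0 => /eqP/nrm_eq0 ->.
have d1 : ip (h · x0) x0 <= ip x0 x0.
  by rewrite hb -nrm_sqr ler_pXn2r ?nnegrE ?nrm_ge0.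
have n0 : 0 < ip x0 x0 by exact: lt_le_trans d1.
(* Half the Rayleigh quotient at [x0]: strictly below the quotient, and at most 1/2 because
   [h <= 1]. *)
pose eps := ip (h · x0) x0 / (2 * ip x0 x0).
have epsE : eps * ip x0 x0 = ip (h · x0) x0 / 2 by rewrite /eps; field; exact: lt0r_neq0.
have e0 : 0 < eps by rewrite divr_gt0 // mulr_gt0.
have e2 : eps <= 2^-1.
  by rewrite ler_pdivrMr ?mulr_gt0 // mulrA mulVf ?pnatr_eq0 // mul1r.
have [||e [ep en eh eeps]] := spectral_proj ha hX h1 (eps := eps).
- by rewrite e0.
- by exists x0; rewrite epsE; lra.
(* [e h = e (1 - u)], and [1 - u] is invertible on the right because [0 <= u <= 1 - eps]. *)
pose u := e * (1 - h).
have eC : e * (1 - h) = (1 - h) * e by rewrite mulrBr mulrBl mulr1 mul1r eh.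
have uE : u = e * (1 - h) * e by rewrite -mulrA -eC mulrA projK.
have ua : vn_adj u u.
  rewrite uE -{2}mulrA; apply: (vn_adjM (vn_adjM (proj_adj ep) _) (proj_adj ep)).
  by apply: vn_adjB; [exact: vn_adj1|].
have ex x : ip (e · x) x <= ip x x.
  have := sqr_ge0 (nrm ((1 - e) · x)); rewrite -ip_proj; last exact: projC.
  by rewrite appDl appNl app1l ipBl subr_ge0.
have u0 x : 0 <= ip (u · x) x.
  rewrite uE !appMl (vn_adj_ip (proj_adj ep)).
  by have := h1 (e · x); rewrite evB ev1 evX.
have u1 x : ip (u · x) x <= (1 - eps) * ip x x.
  rewrite /u mulrBr mulr1 appDl appNl ipBl.
  have e1 : 0 <= 1 - eps by lra.
  by have := ler_wpM2l e1 (ex x); have := eeps x; lra.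
pose m := 1 - eps.
have m0 : 0 < m by rewrite /m; lra.
have um x : nrm (u · x) <= m * nrm x.
  pose v := (m^-1)%:C *: u.
  have va : vn_adj v v by exact: vn_adjZ.
  have := @ev_contraction _ _ _ v va 'X x; rewrite evX /v appZl nrmZ.
  rewrite gtr0_norm ?invr_gt0 // ler_pdivrMl //; apply.
    by move=> y; rewrite evX appZl ipZl mulr_ge0 // invr_ge0 ltW.
  move=> y; rewrite evB ev1 evX appDl appNl appZl ipBl ipZl subr_ge0.
  by rewrite ler_pdivrMl.
have [|c cE] := neumann _ um; first by rewrite /m; lra.
exists (b * e * c); rewrite !mulrA -/h -eh.
suff -> : e * h = e * (1 - u) by rewrite -mulrA cE mulr1.
have eu : e * u = u by rewrite /u mulrA (projK ep).
by rewrite mulrBr mulr1 eu /u mulrBr mulr1 subKr.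
Qed.

End SpectralProjection.

(** * Limits of increasing projections and exhaustion of right ideals *)

Section Exhaustion.
Variables (R : realType) (H : hilbertSpace R) (M : vonNeumannAlgebra H).
Variables (tau : {scalar M}) (tauM : faithful_normal_tracial_state tau).
Implicit Types (p q e : M) (x : H).

Lemma proj_contraction p x : projection p -> nrm (p · x) <= nrm x.
Proof.
move=> pp; have := sqr_ge0 (nrm ((1 - p) · x)).
rewrite -ip_proj; last exact: projC.
rewrite appDl appNl app1l ipBl subr_ge0 ip_proj // -nrm_sqr.
by rewrite ler_pXn2r ?nnegrE ?nrm_ge0.
Qed.

Lemma proj_increasing_lim (p : nat -> M) : (forall n, projection (p n)) ->
  (forall m n, (n <= m)%N -> p n * p m = p n) ->
  exists P, [/\ projection P, forall n, p n * P = p n &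
    forall d, 0 < d -> exists n, forall m, (n <= m)%N -> tr tau P - tr tau (p m) < d].
Proof.
move=> pp pm.
have pB m n x : (n <= m)%N -> ip (p m · x) x - ip (p n · x) x = nrm (p m · x - p n · x) ^+ 2.
  move=> nm; have /ip_proj : projection (p m - p n) by exact: projB (pm _ _ nm).
  by move=> /(_ x); rewrite appDl appNl ipBl.
have pB0 m n x : (n <= m)%N -> ip (p n · x) x <= ip (p m · x) x.
  by move=> /(pB _ _ x) h; rewrite -subr_ge0 h sqr_ge0.
have [|x|P Plim _] := @slim_ex _ _ _ p 1.
- by move=> n x; rewrite mul1r proj_contraction.
- apply: (@hcauchy_monotone _ _ (fun n => ip (p n · x) x) (ip x x)) => [n|m n nm].
    rewrite ip_proj // -nrm_sqr ler_pXn2r ?nnegrE ?nrm_ge0 //.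
    exact: proj_contraction.
  by rewrite -pB.
have pP n : p n * P = p n.
  apply: vn_ext => x; apply: (hcvg_uniq (hcvg_app (p n) (Plim x))) => d d0.
  by exists n => m nm; rewrite -appMl pm // subrr nrm0.
have Pa : vn_adj P P by apply: slim_adj Plim => n; exact: proj_adj.
exists P; split=> //.
  split=> //; apply: vn_ext => x; apply: (hcvg_uniq (Plim (P · x))) => d.
  by move=> /(Plim x)[N hN]; exists N => n /hN; rewrite -!appMl pP.
move=> d d0.
have [n hn] : exists n, tr tau P - tr tau (p n) < d.
  apply: contrapT => /forallNP h.
  suff : tr tau P <= tr tau P - d by lra.
  apply: (tr_slim_le tauM (T := p)) => // [n|n x|n].
  - exact: proj_adj.
  - by rewrite ip_proj // sqr_ge0.
  - by have /negP := h n; rewrite -leNgt; lra.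
exists n => m nm; apply: le_lt_trans hn; rewrite lerD2l lerN2.
apply: (tr_le tauM); apply: proj_positive; exact: projB (pm _ _ nm).
Qed.

(* Greedy exhaustion: each step adds a projection of J orthogonal to the
   previous ones of at least half the largest possible trace. *)
Lemma right_ideal_exhaustion (J : set M) : J 0 ->
  (forall a b, J a -> J b -> J (a + b)) ->
  exists (p : nat -> M) (P : M),
    [/\ forall n, projection (p n) /\ J (p n), projection P,
        (forall m n, (n <= m)%N -> p n * p m = p n) /\ (forall n, p n * P = p n),
        forall d, 0 < d -> exists n, forall m, (n <= m)%N ->
          tr tau P - tr tau (p m) < d &
        forall e, projection e -> J e -> e * P = 0 -> e = 0].
Proof.
move=> J0 JD.
have /choice[g gP] : forall p, exists q, [/\ projection q, J q, p * q = 0 &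
    forall e, projection e -> J e -> p * e = 0 -> tr tau e <= 2 * tr tau q].
  move=> p; pose A := [set tr tau q | q in [set q | [/\ projection q, J q & p * q = 0]]]%classic.
  have A0 : A 0.
    by exists 0; [split; [exact: proj0| |rewrite mulr0]|exact: tr0].
  have Aub : has_ubound A by exists 1 => _ [q [qp _ _] <-]; exact: tr_proj_le1.
  have Ale e : projection e -> J e -> p * e = 0 -> tr tau e <= sup A.
    by move=> ep Je pe; apply: ub_le_sup => //; exists e.
  (* When the supremum is zero no positive margin is available and [q = 0] serves; otherwise the
     margin [sup A / 2] yields the factor 2. *)
  have [s0|s0] := leP (sup A) 0.
    exists 0; split=> // [||e ep Je pe]; [exact: proj0|by rewrite mulr0|].
    by rewrite tr0 mulr0; exact: le_trans (Ale _ ep Je pe) s0.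
  have s2 : 0 < sup A / 2 by rewrite divr_gt0.
  have [_ [q [qp Jq pq] <-] hq] := sup_adherent s2 (conj (ex_intro _ 0 A0) Aub).
  exists q; split=> // e ep Je pe.
  by have := Ale e ep Je pe; lra.
pose p n := iter n (fun p => p + g p) 0.
have pS n : p n.+1 = p n + g (p n) by [].
have pp n : projection (p n) /\ J (p n).
  elim: n => [|n [pn Jn]]; first by split=> //; exact: proj0.
  have [qp Jq pq _] := gP (p n); rewrite pS; split; last exact: JD.
  exact: projD.
have pm m n : (n <= m)%N -> p n * p m = p n.
  elim: m => [|m IH]; first by rewrite leqn0 => /eqP ->; rewrite mul0r.
  rewrite leq_eqVlt => /predU1P[->|]; first by case: (pp m.+1) => /projK.
  rewrite ltnS => /IH nm; have [_ _ pq _] := gP (p m).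
  by rewrite pS mulrDr nm -[p n in X in _ + X]nm -mulrA pq mulr0 addr0.
have [P [Pp pP Pd]] := proj_increasing_lim (fun n => (pp n).1) pm.
exists p, P; split=> // e ep Je eP; apply: (tr_proj_eq0 tauM ep).
(* A leftover [e] competes at every stage, so its trace is at most twice the gain
   [tr (p n.+1) - tr (p n)], itself at most [tr P - tr (p n)]. *)
apply/ler_addgt0Pl => d d0; rewrite addr0.
have [|n hn] := Pd (d / 2); first by rewrite divr_gt0.
have [_ _ _ /(_ e ep Je)] := gP (p n).
have -> : p n * e = 0.
  by rewrite -(pP n) -mulrA (projM_sym ep Pp eP) mulr0.
have := hn n (leqnn n).
have := tr_le tauM (proj_positive (projB (pp n.+1).1 Pp (pP n.+1))).
by rewrite pS trD => h1 h2 /(_ erefl); lra.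
Qed.

End Exhaustion.

(** * Modules and rank *)

Section RankedModules.
Variables (R : realType) (H : hilbertSpace R) (M : vonNeumannAlgebra H).
Variables (tau : {scalar M}) (tauM : faithful_normal_tracial_state tau).

Definition ract (V : lmodType M^c) (v : V) (a : M) : V := (a : M^c) *: v.
Local Notation "v ◁ a" := (ract v a) (at level 40, left associativity).

Section Action.
Variable V : lmodType M^c.
Implicit Types (u v : V) (a b p : M).

Lemma ractM v a b : v ◁ a ◁ b = v ◁ (a * b).
Proof. by rewrite /ract scalerA. Qed.

Lemma ractDr v a b : v ◁ (a + b) = v ◁ a + v ◁ b.
Proof. exact: scalerDl. Qed.

Lemma ractBr v a b : v ◁ (a - b) = v ◁ a - v ◁ b.
Proof. exact: scalerBl. Qed.

Lemma ract0r v : v ◁ 0 = 0.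
Proof. exact: scale0r. Qed.

Lemma ract1r v : v ◁ 1 = v.
Proof. exact: scale1r. Qed.

Lemma ractDl u v a : (u + v) ◁ a = u ◁ a + v ◁ a.
Proof. exact: scalerDr. Qed.

Lemma ractBl u v a : (u - v) ◁ a = u ◁ a - v ◁ a.
Proof. exact: scalerBr. Qed.

Lemma ract0l a : (0 : V) ◁ a = 0.
Proof. exact: scaler0. Qed.

(** Trades the supremum for a witness; the set of traces contains 0 (from [p = 0]) and is bounded by
    1. *)
Lemma rank_ltP v (d : R) : rank tau v < d <->
  exists p, [/\ projection p, v ◁ p = 0 & tr tau (1 - p) < d].
Proof.
rewrite /rank; set A := [set _ | _ in _]%classic.
have A0 : A !=set0%classic.
  by exists 0; exists 0; [split; [exact: proj0|exact: ract0r]|exact: (tr0 tau)].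
have Aub : has_ubound A by exists 1 => _ [p [pp _] <-]; exact: tr_proj_le1.
split=> [h|[p [pp vp]]].
  have {}h : 1 - d < sup A by lra.
  have [_ [p [pp vp] <-] hp] := sup_gt A0 h.
  by exists p; split=> //; rewrite trB tr1 // /tr; lra.
rewrite trB tr1 //; have : tr tau p <= sup A by apply: ub_le_sup => //; exists p.
lra.
Qed.

Lemma rank_separated_eq0 v : rank_separated tau V ->
  (forall d, 0 < d -> rank tau v < d) -> v = 0.
Proof.
move=> sep v0; apply: sep; rewrite /rank_dist subr0; apply/le_anti/andP; split.
  by apply/ler_addgt0Pl => d d0; rewrite addr0 ltW // v0.
rewrite leNgt; apply/negP => /rank_ltP[p [pp _]].
by apply/negP; rewrite -leNgt tr_proj_ge0 //; exact: projC.
Qed.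

(** As [v] kills [p], it suffices that [a r = p a r], that is, that [r] lies in the kernel of
    [(1 - p) a]. *)
Lemma ract_ker_proj v a p : projection p -> v ◁ p = 0 ->
  exists r, [/\ projection r, v ◁ a ◁ r = 0 & tr tau (1 - r) <= tr tau (1 - p)].
Proof.
move=> pp vp; have [||r [rp ar rt]] := kernel_proj tauM (p := 1 - p) (a := (1 - p) * a).
- exact: projC.
- by rewrite mulrA projK //; exact: projC.
exists r; split=> //; rewrite ractM.
have -> : a * r = p * (a * r).
  by apply/eqP; rewrite -subr_eq0 -[X in X - _]mul1r -mulrBl mulrA ar.
by rewrite -ractM vp ract0l.
Qed.

Lemma rank_ract v a (d : R) : rank tau v < d -> rank tau (v ◁ a) < d.
Proof.
move=> /rank_ltP[p [pp vp pd]]; have [r [rp vr rt]] := ract_ker_proj a pp vp.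
by apply/rank_ltP; exists r; split=> //; exact: le_lt_trans pd.
Qed.

Lemma rank_dist_ltC u v (d : R) : rank_dist tau u v < d -> rank_dist tau v u < d.
Proof. by rewrite /rank_dist -[v - u]opprB -(scaleN1r (u - v)); exact: rank_ract. Qed.

End Action.

(** * Complements of rank-complete submodules *)

Section Injectivity.
Variables (F : lmodType M^c) (S : {pred F}) (E : subLmodType S).
Hypothesis Ecomplete : rank_complete tau E.
Local Notation val := (\val : E -> F).

(** Membership of 0 is not demanded, so that the empty union of the empty chain qualifies in Zorn's
    lemma; maximality restores it. *)
Definition independent (C : set F) :=
  [/\ forall u v, C u -> C v -> C (u + v), forall v a, C v -> C (v ◁ a) &
      forall x : E, C (val x) -> x = 0].

Lemma val_ract (x : E) a : val (x ◁ a) = val x ◁ a.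
Proof. exact: linearZ. Qed.

(** The last clause is maximality tested against the submodule C + vM. *)
Lemma maximal_independent : exists C : set F, [/\ independent C, C 0 &
  forall v : F, (forall c a (x : E), C c -> c + v ◁ a = val x -> x = 0) -> C v].
Proof.
have [|C [[CD CM CE] Cmax]] := @Zorn_bigcup F independent.
  move=> G GP Gtot; split=> [u v [X GX Xu] [Z GZ Zv]|v a [X GX Xv]|x [X GX Xx]].
  - have [XZ|ZX] := Gtot X Z GX GZ.
      by exists Z => //; have [+ _ _] := GP Z GZ; apply=> //; exact: XZ.
    by exists X => //; have [+ _ _] := GP X GX; apply=> //; exact: ZX.
  - by exists X => //; have [_ + _] := GP X GX; apply.
  - by have [_ _ +] := GP X GX; apply.
have C0 : C 0.
  have [[c Cc]|Cn] := pselect (exists c, C c); first by rewrite -(ract0r c); exact: CM.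
  exfalso; apply: (Cmax [set 0]%classic).
    by split=> [s Cs|/(_ 0 erefl) Cs]; [case: Cn; exists s|apply: Cn; exists 0].
  split=> [u v -> ->|v a ->|x /= x0]; [exact: addr0|exact: ract0l|].
  by apply: val_inj; rewrite x0 raddf0.
exists C; split=> // v vE; apply: contrapT => Cv.
apply: (Cmax [set c + v ◁ a | c in C & a in setT]%classic).
  split=> [c Cc|sub]; first by exists c => //; exists 0 => //; rewrite ract0r addr0.
  apply: Cv; apply: sub; exists 0 => //; exists 1 => //.
  by rewrite ract1r add0r.
split.
- move=> _ _ [c Cc [a _ <-]] [c' Cc' [a' _ <-]].
  exists (c + c'); first exact: CD.
  by exists (a + a') => //; rewrite ractDr addrACA.
- move=> _ b [c Cc [a _ <-]]; exists (c ◁ b); first exact: CM.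
  by exists (a * b) => //; rewrite ractDl ractM.
by move=> x [c Cc [a _]]; exact: vE.
Qed.

Lemma rank_complete_complement : exists C : set F, independent C /\
  forall v : F, exists x : E, C (v - val x).
Proof.
have [C [[CD CM CE] C0 Cmax]] := maximal_independent.
have CN v : C v -> C (- v) by rewrite -scaleN1r; exact: CM.
exists C; split=> // v.
have uniq (u : F) (x y : E) : C (u - val x) -> C (u - val y) -> x = y.
  move=> ux uy; apply/eqP; rewrite -subr_eq0; apply/eqP/CE.
  have := CD _ _ uy (CN _ ux); congr (C _).
  by rewrite [RHS]raddfB /= opprB addrC addrA subrK.
pose J : set M := [set a | exists x : E, C (v ◁ a - val x)]%classic.
have J0 : J 0 by exists 0; rewrite ract0r raddf0 subr0.
have JD a b : J a -> J b -> J (a + b).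
  move=> [x Cx] [y Cy]; exists (x + y).
  by rewrite ractDr raddfD /= opprD addrACA; exact: CD.
have JM a b : J a -> J (a * b).
  by move=> [x Cx]; exists (x ◁ b); rewrite val_ract -ractM -ractBl; exact: CM.
have [p [P [pJ Pp [pm pP] Pd PJ]]] := right_ideal_exhaustion tauM J0 JD.
have pp n := (pJ n).1; have [Esep Ecvg] := Ecomplete.
have /choice[e eC] : forall n, exists x : E, C (v ◁ p n - val x) by move=> n; case: (pJ n).
have mp m n : (n <= m)%N -> p m * p n = p n.
  by move=> /pm; exact: projM_abs.
have Pp' n : P * p n = p n by exact: projM_abs.
have ep m n : (n <= m)%N -> e m ◁ p n = e n.
  move=> nm; apply: (uniq (v ◁ p n)) => //.
  by rewrite val_ract -{1}(mp _ _ nm) -ractM -ractBl; exact: CM.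
have [x ex] : exists x, rank_cvg tau e x.
  apply: Ecvg => d d0; have [N hN] := Pd d d0; exists N => m n Nm Nn.
  wlog nm : m n Nm Nn / (n <= m)%N.
    move=> wl; have [/wl|/ltnW mn] := leqP n m; first exact.
    by apply: rank_dist_ltC; exact: wl.
  (* [e m - e n = e m (p m - p n)], so the complement of [p m - p n] kills it. *)
  apply/rank_ltP; exists (1 - (p m - p n)); split.
  - by apply/projC/projB => //; exact: pm.
  - have enm : e n ◁ p m = e n by rewrite -{1}(ep n n) // ractM pm // ep.
    rewrite ractBr ract1r ractBr !ractBl enm (ep m m) // (ep m n) // (ep n n) //.
    by rewrite subrr subr0 subrr.
  - rewrite subKr trB; have := tr_le tauM (proj_positive (projB (pp m) Pp (pP m))).
    have := hN _ Nn; lra.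
have xlim a y N : (forall m, (N <= m)%N -> e m ◁ a = y) -> x ◁ a = y.
  move=> ey; apply/eqP; rewrite -subr_eq0; apply/eqP.
  apply: rank_separated_eq0 => // d /ex[n hn].
  rewrite -(ey _ (leq_maxl N n)) -ractBl; apply: rank_ract.
  by apply: rank_dist_ltC; apply: hn; exact: leq_maxr.
have xp n : x ◁ p n = e n by apply: (xlim _ _ n) => m; exact: ep.
pose w := v ◁ P - val (x ◁ P).
have wp n : C (w ◁ p n).
  by rewrite /w ractBl -val_ract !ractM Pp' xp.
have wP : w ◁ P = w by rewrite /w val_ract -ractBl ractM projK.
have Cw : C w.
  (* Let [c + w a = y] with [y] in E. On a projection [r] of trace close to 1, [P a r = p_n a r], so
     [w a r = w p_n a r] lies in C. Hence [y r] lies in C and vanishes, and [y] has arbitrarily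
     small rank. *)
  apply: Cmax => c a y Cc ca; apply: rank_separated_eq0 => // d /Pd[n hn].
  have [||r [rp ar rt]] := kernel_proj tauM (p := P - p n) (a := (P - p n) * a).
  - exact: projB.
  - by rewrite mulrA projK //; exact: projB.
  apply/rank_ltP; exists r; split=> //; last first.
    by apply: le_lt_trans rt _; rewrite trB; exact: hn.
  apply: CE; rewrite val_ract -ca ractDl; apply: CD; first exact: CM.
  rewrite -wP !ractM; have -> : P * (a * r) = p n * (a * r).
    by apply/eqP; rewrite -subr_eq0 -mulrBl mulrA ar.
  by rewrite -ractM; exact: CM.
have Cv : C (v ◁ (1 - P)).
  (* If [c + v (1 - P) a = y] then [(1 - P) a] lies in [J]. Were it nonzero, [J] would contain a
     nonzero projection orthogonal to [P]. *)
  apply: Cmax => c a y Cc ca.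
  have [a0|a0] := eqVneq ((1 - P) * a) 0.
    by apply: CE; rewrite -ca ractM a0 ract0r addr0.
  have [b [bp bn]] := right_ideal_proj a0.
  case/eqP: bn; apply: PJ => //.
    apply: JM; exists y; rewrite -ca ractM opprD addrCA subrr addr0.
    exact: CN.
  apply: projM_sym => //.
  by rewrite !mulrA mulrBr mulr1 projK // subrr !mul0r.
exists (x ◁ P); have := CD _ _ Cw Cv; congr (C _).
by rewrite /w ractBr ract1r addrC addrA subrK.
Qed.

End Injectivity.
End RankedModules.

Theorem theoremB41 (R : realType) (H : hilbertSpace R)
    (M : vonNeumannAlgebra H) (tau : {scalar M})
    (finM : vn_finite M) (sigmaM : vn_sigma_finite M)
    (tauM : faithful_normal_tracial_state tau)
    (F : lmodType M^c) (S : {pred F}) (E : subLmodType S) (Y : lmodType M^c)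
    (Ecomplete : rank_complete tau E) (Fcomplete : rank_complete tau F)
    (Ycomplete : rank_complete tau Y)
    (phi : {linear E -> Y}) :
  exists psi : {linear F -> Y}, forall x : E, psi (\val x) = phi x.
Proof.
have [C [[CD CM CE] Cex]] := rank_complete_complement tauM Ecomplete.
have [f fC] := choice Cex.
have uniq (u : F) (x y : E) : C (u - \val x) -> C (u - \val y) -> x = y.
  move=> ux uy; apply/eqP; rewrite -subr_eq0; apply/eqP/CE.
  have := CD _ _ uy (CM _ (-1) ux); rewrite [ract _ _]scaleN1r; congr (C _).
  by rewrite [RHS]raddfB /= opprB addrC addrA subrK.
(* [f] is a mere choice of E-components; their uniqueness makes it linear. *)
have fl : linear f.
  move=> a u v; apply: (uniq (a *: u + v)) => //.
  rewrite linearP /= opprD addrACA -scalerBr; apply: CD => //.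
  by apply: (CM _ a).
pose lin := GRing.isLinear.Build M^c F E *:%R f fl.
pose g : {linear F -> E} := HB.pack f lin.
exists (phi \o g) => x /=; congr (phi _).
(* 0 belongs to C as a member of C acted on by 0, so [x] is its own E-component. *)
by apply: (uniq (\val x)) => //; rewrite subrr -(ract0r (\val x - \val (f (\val x)))); exact: CM.
Qed.
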